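(* Let $p$ be an odd prime, $m$ an even integer, $l$ a positive integer with $\gcd(m,l)=1$, $q=p^m$, and $\mathrm{Tr}$ the trace from $\mathbb{F}_q$ onto $\mathbb{F}_p$. Let $$\mathcal{D}_1=\{(\mathrm{Tr}(ax^{p^l+1}+bx^2+cx)+h)_{x\in\mathbb{F}_q}: a,b,c\in\mathbb{F}_q, h\in\mathbb{F}_p\}$$ with coordinates indexed by $\mathbb{F}_q$, and for each $i$ with $A_i\neq0$ let $\mathcal{B}$ be the set of supports of the codewords of $\mathcal{D}_1$ of weight $i$. Then for $m\geq 6$, $(\mathbb{F}_q,\mathcal{B})$ is a $2$-$(p^m,i,\lambda)$ design for the following pairs $(i,\lambda)$: 1. $(p^m-p^{m-1},\ (p^m-p^{m-1}-1)(p^{2m-1}-p^{2m-2}+2p^{2m-3}-p^{m-2}+1))$; 2. $(p^m-p^{m-1}+p^{\frac{m}{2}}-p^{\frac{m-2}{2}},\ p^{\frac{m+2}{2}}[p^m-p^{m-1}+p^{\frac{m-2}{2}}(p-1)-1](p^{\frac{m}{2}}+1)(p^m-p^{m-1}-p^{m-2}-p^{\frac{m}{2}}+p^{\frac{m-2}{2}}+1)/2(p^2-1))$; 3. $(p^m-p^{m-1}-p^{\frac{m}{2}}+p^{\frac{m-2}{2}},\ p^{\frac{m+2}{2}}[p^m-p^{m-1}-p^{\frac{m-2}{2}}(p-1)-1](p^{\frac{m}{2}}-1)(p^m-p^{m-1}-p^{m-2}+p^{\frac{m}{2}}-p^{\frac{m-2}{2}}+1)/2(p^2-1))$; 4. $(p^m-p^{m-1}-p^{\frac{m+2}{2}}+p^{\frac{m}{2}},\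 p^{\frac{m}{2}-2}(p^{m-2}-1)(p^{\frac{m}{2}}-1)(p^m-p^{m-1}-p^{\frac{m+2}{2}}+p^{\frac{m}{2}}-1)/2(p^2-1))$; 5. $(p^m-p^{m-1}+p^{\frac{m}{2}-1},\ p^{\frac{m+2}{2}}(p^m-p^{m-1}+p^{\frac{m-2}{2}}-1)(p^{\frac{m}{2}+1}-p^{\frac{m}{2}}+1)(p^m-p^{m-1}-p^{m-2}+p^{\frac{m}{2}}-p^{\frac{m-2}{2}}+1)/2(p^2-1))$; 6. $(p^m-p^{m-1}+p^{\frac{m}{2}},\ p^{\frac{m}{2}-2}(p^m-p^{m-1}+p^{\frac{m}{2}}-1)(p^{\frac{m}{2}}-p^{\frac{m}{2}-1}+1)(p^{m+2}-p^m+p^{m-1}+p^{\frac{m}{2}}-p^{\frac{m}{2}-1}-1)/2(p^2-1))$; 7. $(p^m-p^{m-1}-p^{\frac{m}{2}-1},\ p^{\frac{m+2}{2}}(p^m-p^{m-1}-p^{\frac{m-2}{2}}-1)(p^{\frac{m}{2}+1}-p^{\frac{m}{2}}-1)(p^m-p^{m-1}-p^{m-2}-p^{\frac{m}{2}}+p^{\frac{m-2}{2}}+1)/2(p^2-1))$; 8. $(p^m-p^{m-1}-p^{\frac{m}{2}},\ p^{\frac{m}{2}-2}(p^m-p^{m-1}-p^{\frac{m}{2}}-1)(p^{\frac{m}{2}}-p^{\frac{m}{2}-1}-1)(p^{m+2}-p^m+p^{m-1}-p^{\frac{m}{2}}+p^{\frac{m}{2}-1}-1)/2(p^2-1))$;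 9. $(p^m-p^{m-1}+p^{\frac{m}{2}}(p-1),\ p^{\frac{m}{2}-2}(p^{m-2}-1)(p^{\frac{m}{2}}+1)[p^m-p^{m-1}+p^{\frac{m}{2}}(p-1)-1]/2(p^2-1))$. Moreover, for $m=4$, $(\mathbb{F}_q,\mathcal{B})$ is a $2$-$(p^4,i,\lambda)$ design for the pairs 1–8 above (not including pair 9).
   Context: The support of a codeword $(c_x)_{x\in\mathbb{F}_q}$ is $\{x: c_x\neq0\}$; $A_i$ is the number of codewords of Hamming weight $i$. A $2$-$(v,k,\lambda)$ design is a pair $(\mathcal{P},\mathcal{B})$ with $|\mathcal{P}|=v$ and $\mathcal{B}$ a set of $k$-subsets of $\mathcal{P}$ such that every $2$-subset of $\mathcal{P}$ lies in exactly $\lambda$ members of $\mathcal{B}$. Expressions of the form $X/2(p^2-1)$ mean $X/(2(p^2-1))$. In the paper $\mathcal{D}_1$ is denoted $\overline{\mathcal{C}_1^{\perp}}^{\perp}$. *)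

(* Defs.v *)
From HB Require Import structures.
From mathcomp Require Import all_boot all_order all_algebra all_fingroup.
From mathcomp Require Import all_solvable all_field.

Set Implicit Arguments.
Unset Strict Implicit.
Unset Printing Implicit Defensive.

Import GRing.Theory.
Local Open Scope ring_scope.

Section Designs.

Variable P : finType.

Definition is_2_design (v k lam : nat) (B : {set {set P}}) : Prop :=
  [/\ #|P| = v,
      forall b : {set P}, b \in B -> #|b| = k
    & forall T : {set P}, #|T| = 2%N -> #|[set b in B | T \subset b]| = lam].

End Designs.

Section Codes.

Variables (I : finType) (K : finFieldType).
Implicit Types (w : {ffun I -> K}) (C : {set {ffun I -> K}}).

Definition supp w : {set I} := [set x | w x != 0].

Definition wt w : nat := #|supp w|.

Definition num_wt C (i : nat) : nat := #|[set w in C | wt w == i]|.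

Definition supports C (i : nat) : {set {set I}} :=
  [set supp w | w in C & wt w == i].

End Codes.

Section Trace.

Variables (F : finFieldType) (p m : nat).

Definition frob_sum (x : F) : F := \sum_(i < m) x ^+ (p ^ i).

(* The trace F_q -> F_p for q = p ^ m, x |-> x + x^p + ... + x^(p^(m-1)), with
   its value read in 'F_p through the embedding t |-> t%:R of 'F_p in F.  When
   #|F| = p ^ m and p is prime such a t exists and is unique (Tr_embed, and
   injectivity of the embedding), so the default value 0 is never used. *)
Definition Tr (x : F) : 'F_p :=
  odflt 0 [pick t : 'F_p | (t : nat)%:R == frob_sum x].

End Trace.

Arguments Tr {F} p m x.

Section Code.

Variables (F : finFieldType) (p m l : nat).

Definition codeword (a b c : F) (h : 'F_p) : {ffun F -> 'F_p} :=
  [ffun x => Tr p m (a * x ^+ (p ^ l + 1) + b * x ^+ 2 + c * x) + h].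

Definition D1 : {set {ffun F -> 'F_p}} :=
  [set codeword u.1.1.1 u.1.1.2 u.1.2 u.2 | u : F * F * F * 'F_p].

(* (i, lam) are computed in rat, where the differences are not truncated and
   the quotients are exact; that they are natural numbers is part of the
   claim. *)
Definition supports_form_2_design (i lam : rat) : Prop :=
  exists k n : nat,
    [/\ k%:R = i, n%:R = lam, num_wt D1 k != 0%N
      & is_2_design (p ^ m) k n (supports D1 k)].

End Code.

Arguments D1 F p m l : clear implicits.
Arguments supports_form_2_design F p m l i lam : clear implicits.

Section TraceFacts.

Variables (F : finFieldType) (p m : nat).
Hypotheses (p_pr : prime p) (cardF : #|F| = (p ^ m)%N).

Let charFp : p \in [pchar F] := card_finPcharP cardF p_pr.

Lemma Fp_embed_inj : injective (fun t : 'F_p => (t : nat)%:R : F).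
Proof.
move=> s t /eqP; rewrite -(inj_eq (mulIf (oner_neq0 F))) => /eqP.
have scaleE (u : 'F_p) : (u : nat)%:R * 1 = u%:A :> pPrimeCharType charFp by [].
move=> st; apply: (fmorph_inj (in_alg (pPrimeCharType charFp))).
by rewrite /= -!scaleE.
Qed.

Lemma frob_sum_galTrace (x : F) :
  frob_sum p m x =
  galTrace 1 {: pPrimeCharType charFp} (x : pPrimeCharType charFp).
Proof.
set L : splittingFieldType 'F_p := pPrimeCharType charFp.
have sub1L : (1 <= {:L})%VS by apply: subvf.
have [alpha /eqP genL alphaE] := finField_galois_generator sub1L.
have alphaXE i (y : L) : (alpha ^+ i)%g y = y ^+ (p ^ i).
  elim: i => [|i IHi]; first by rewrite expg0 gal_id.
  rewrite expgSr galM ?memvf // IHi alphaE ?memvf // dimv1 expn1 card_Fp //.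
  by rewrite -exprM expnSr.
have ord_alpha : #[alpha]%g = m.
  rewrite orderE -genL -galois_dim; last exact: finField_galois.
  rewrite dimv1 divn1 (pprimeChar_dimf charFp).
  have -> : #|pPrimeCharType charFp| = (p ^ m)%N by rewrite -cardF.
  by rewrite pfactorK.
have cycE : <[alpha]>%g = [set (alpha ^+ (i : 'I_m))%g | i in 'I_m].
  apply/setP=> y; apply/idP/imsetP => [/cyclePmin[i lti ->] | [i _ ->]].
    by rewrite ord_alpha in lti; exists (Ordinal lti).
  exact: mem_cycle.
rewrite /galTrace genL cycE big_imset /=; last first.
  move=> i j _ _ /eqP; rewrite eq_expg_mod_order ord_alpha !modn_small //.
  by move/eqP/val_inj.
by apply: eq_bigr => i _; rewrite alphaXE.
Qed.

Lemma Tr_embed (x : F) : (Tr p m x : nat)%:R = frob_sum p m x.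
Proof.
rewrite /Tr; case: pickP => [t /eqP // | no_t].
have [t Dt] : exists t : 'F_p, (t : nat)%:R = frob_sum p m x.
  set L : splittingFieldType 'F_p := pPrimeCharType charFp.
  have gal1L : galois 1 {:L} by apply: finField_galois; apply: subvf.
  have /vlineP[t Dt] := mem_galTrace gal1L (memvf (x : L)).
  by exists t; rewrite frob_sum_galTrace Dt -[LHS]mulr1.
by have := no_t t; rewrite Dt eqxx.
Qed.

End TraceFacts.

(* Main.v *)
Require Import Defs.
From HB Require Import structures.
From mathcomp Require Import all_boot all_order all_algebra all_fingroup.
From mathcomp Require Import all_solvable all_field.
From mathcomp Require Import zify ring lra.

Set Implicit Arguments.
Unset Strict Implicit.
Unset Printing Implicit Defensive.

Import Order.TTheory GRing.Theory Num.Theory.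
Local Open Scope ring_scope.

(* Write Q x = Tr (a x^(p^l+1) + b x^2) and let K be its radical.  Up to a
   translation, Tr (c x) + h either shifts the value of Q by a constant or, when
   Tr (c _) does not vanish on K, makes the word balanced, so weights are read off
   the level sizes N v = #{x | Q x = v}.  N is constant on the classes of nonzero
   squares and nonsquares, and counting {(x, y) | Q x = Q y} gives
   T^2 + p d^2 = q #|K| with integers T and d; descent at p then determines T and
   d up to sign from #|K|.  For (a, b) <> 0 the Wronskian
   a (x^(p^l) y - y^(p^l) x) is F_p-valued on K, so #|K| is 1, p or p^2.  The
   number of forms of each type (#|K|, T) follows from the sums over all (a, b) of
   1, #|K|, (#|K| - 1)(#|K| - p), T and T #|K|, which are elementary because the
   forms whose radical contains x <> 0 are parametrised by a and satisfy
   Q (x z) = - Tr (a x^(p^l+1) (z^(p^l) - z)^2) / 2.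
   The code is invariant under the affine group, which is 2-transitive, so its
   supports form 2-designs; words of equal weight k and equal support are
   proportional because k (p - 2) < d (p - 1) for the minimum distance d. *)

(** * Counting *)

(** No character sums enter: [gsum], the rational number that they would contribute on average,
    equals the integer [T] read off the level sizes. The sign of [T] is never decided for an
    individual form; only the number of forms of each sign is, which is why moments of [T] are
    needed beside those of [#|K|]. Since [m] is even, [T] vanishes when [#|K| = p] and has two
    possible signs when [#|K|] is [1] or [p ^ 2]: five unknown type counts, against five moments.
    With [m = 2 * r.+1] and [t = p ^ r], the mean number of zeros of a word is [q / p = p * t ^ 2],
    and each of the nine weights is [q - (p * t ^ 2 + t * c)] with [c] equal to [0] or, up to sign,
    to [1], [p - 1], [p] or [p * (p - 1)]. Everything after the moments is algebra in [p] and [t],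
    with [c] as label of the weight. *)

Lemma card_regular_fibres (T U : finType) (D : {set T}) (f : T -> U) (n : nat) :
  (forall x, x \in D -> #|[set y in D | f y == f x]| = n) ->
  #|D| = (n * #|f @: D|)%N.
Proof.
move=> fibn; rewrite -sum1_card (partition_big_imset f) /=.
rewrite (eq_bigr (fun _ => n)) ?sum_nat_const 1?mulnC // => _ /imsetP[x Dx ->].
by rewrite sum1dep_card -(fibn x Dx).
Qed.

(** Since [s (w - u)] embeds the fibre over [u] into the fibre over [w], any two fibres bound each
    other. The balancedness statements below use it with [s] a translation. *)
Lemma card_equidistributed (T : finType) (p : nat) (D : {set T})
    (f : T -> 'F_p) (s : 'F_p -> T -> T) :
    prime p -> (forall t, injective (s t)) ->
    (forall t x, x \in D -> s t x \in D) ->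
    (forall t x, x \in D -> f (s t x) = f x + t) ->
  forall v, (p * #|[set x in D | f x == v]|)%N = #|D|.
Proof.
move=> p_pr s_inj sD fs v.
have le_fib u w : (#|[set x in D | f x == u]| <= #|[set x in D | f x == w]|)%N.
  rewrite -(card_imset _ (s_inj (w - u))); apply/subset_leq_card/subsetP.
  move=> _ /imsetP[x /setIdP[Dx /eqP fx] ->].
  by rewrite inE sD //= fs // fx addrC subrK.
rewrite -[RHS]sum1_card (partition_big f xpredT) //= -{1}(card_Fp p_pr).
rewrite (eq_bigr (fun _ => #|[set x in D | f x == v]|)) ?sum_nat_const //.
by move=> u _; rewrite sum1dep_card; apply/eqP; rewrite eqn_leq !le_fib.
Qed.

(** The equation forces [p] to divide [t]; dividing by [p] exchanges the two unknowns and lowers [k]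
    by one, down to [t ^ 2 + p * d ^ 2 = 1]. The exchange is why the parity of [k] decides which
    unknown vanishes. *)
Lemma sum_square_prime_multiple_eq_pow (p k t d : nat) : prime p ->
    (t ^ 2 + p * d ^ 2 = p ^ k)%N ->
  if odd k then (t = 0)%N /\ (d = p ^ k./2)%N else (d = 0)%N /\ (t = p ^ k./2)%N.
Proof.
move=> p_pr; have p_gt1 := prime_gt1 p_pr.
elim: k t d => [|k IHk] t d.
  rewrite expn0 /=; case: d => [|d]; last by nia.
  by case: t => [|[|t]] //; nia.
move=> eq_k.
have p_t : (p %| t)%N.
  have: (p %| t ^ 2 + p * d ^ 2)%N by rewrite eq_k expnS dvdn_mulr.
  by rewrite dvdn_addl ?(dvdn_mulr _ (dvdnn p)) // Euclid_dvdX // => /andP[].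
case/dvdnP: p_t eq_k => t' -> eq_k.
have: (d ^ 2 + p * t' ^ 2 = p ^ k)%N.
  apply/eqP; rewrite -(eqn_pmul2l (prime_gt0 p_pr)) -expnS -eq_k.
  by apply/eqP; ring.
move/IHk; rewrite [odd k.+1]/= -uphalfE uphalf_half.
case: (odd k) => -[-> ->]; split => //; first by rewrite add1n expnSr.
Qed.

Lemma eq_sqr_setE (K : finFieldType) (D : {set K}) (x : K) :
    (forall y, (- y \in D) = (y \in D)) -> x \in D ->
  [set y in D | y ^+ 2 == x ^+ 2] = [set x; - x].
Proof.
move=> DN Dx; apply/setP=> y; rewrite !inE eqf_sqr.
by apply/andb_idl => /orP[] /eqP-> //; rewrite DN.
Qed.

(** Squaring is two-to-one here. This serves in ['F_p] to count the nonzero squares, and in [F] to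
    show that nonzero levels have even size. *)
Lemma card_symmetric (K : finFieldType) (D : {set K}) :
    2%:R != 0 :> K -> (forall y, (- y \in D) = (y \in D)) -> 0 \notin D ->
  #|D| = (2 * #|[set x ^+ 2 | x in D]|)%N.
Proof.
move=> two0 DN D0; apply: card_regular_fibres => x Dx.
rewrite (eq_sqr_setE DN Dx) cards2 -addr_eq0 -mulr2n -mulr_natl mulf_neq0 //.
by apply: contraNneq D0 => <-.
Qed.

(** The witnesses are [1] and a nonsquare [g], the nonsquares being the coset of [g]. [G] and its
    codomain are generic because the identity serves for level sizes, for their squares and for
    indicators of a given size. *)
Lemma sum_square_invariant (p : nat) (N : 'F_p -> nat) : prime p -> odd p ->
    (forall t v, t != 0 -> N (t ^+ 2 * v) = N v) ->
  exists u w : 'F_p, [/\ u != 0, w != 0,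
    forall v : 'F_p, v != 0 -> N v = N u \/ N v = N w &
    forall (M : nmodType) (G : nat -> M),
      \sum_v G (N v) = G (N 0) + (G (N u) + G (N w)) *+ p./2].
Proof.
move=> p_pr p_odd N_sq.
have two0 : 2%:R != 0 :> 'F_p.
  by rewrite -(dvdn_pcharf (pchar_Fp p_pr)) gtnNdvd ?odd_prime_gt2.
pose U := [set v : 'F_p | v != 0]; pose Sq := [set v ^+ 2 | v in U].
have cardU : #|U| = (p./2).*2.
  have -> : U = ~: [set 0] by apply/setP=> v; rewrite !inE.
  rewrite cardsC1 card_Fp // -[in LHS](odd_double_half p) p_odd add1n.
  by [].
have cardSq : #|Sq| = p./2.
  apply/eqP; rewrite -(eqn_pmul2l (m := 2)) // [eqbRHS]mul2n -cardU -card_symmetric //.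
    by move=> y; rewrite !inE oppr_eq0.
  by rewrite inE eqxx.
have p2_gt0 : (0 < p./2)%N by rewrite half_gt0 prime_gt1.
have SqU : Sq \subset U.
  by apply/subsetP=> _ /imsetP[v Uv ->]; move: Uv; rewrite !inE expf_eq0.
have cardnS : #|U :\: Sq| = p./2.
  by rewrite cardsD (setIidPr SqU) cardU cardSq -addnn addnK.
have [g] : exists g, g \in U :\: Sq.
  by apply/set0Pn; rewrite -card_gt0 cardnS.
rewrite inE => /andP[gS gU]; have g0 : g != 0 by rewrite inE in gU.
have nSE : U :\: Sq = [set g * v | v in Sq].
  apply/esym/eqP; rewrite eqEcard card_imset; last exact: mulfI.
  rewrite cardnS cardSq leqnn andbT; apply/subsetP=> _ /imsetP[_ /imsetP[v Uv ->] ->].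
  rewrite !inE in Uv *; rewrite mulf_neq0 ?expf_neq0 // andbT.
  apply: contra gS => /imsetP[w Uw gvw]; apply/imsetP; exists (w / v).
    by rewrite !inE in Uw *; rewrite mulf_neq0 ?invr_eq0.
  by rewrite expr_div_n -gvw mulfK ?expf_neq0.
have NSq v : v \in Sq -> N v = N 1.
  by case/imsetP=> t; rewrite inE => t0 ->; rewrite -[t ^+ 2]mulr1 N_sq.
have NnS v : v \in U :\: Sq -> N v = N g.
  rewrite nSE => /imsetP[_ /imsetP[t t0 ->] ->]; rewrite mulrC N_sq //.
  by rewrite inE in t0.
exists 1, g; split=> [| // | v v0 | M G]; first by rewrite oner_eq0.
  have [/NSq|vS] := boolP (v \in Sq); first by left.
  by right; apply: NnS; rewrite !inE vS.
rewrite (bigD1 0) //=; congr (_ + _).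
rewrite (eq_bigl [in U]) => [|v]; last by rewrite inE.
rewrite (big_setID Sq) /= (setIidPr SqU) mulrnDl.
congr (_ + _).
  rewrite (eq_bigr (fun=> G (N 1))) ?sumr_const ?cardSq // => v /NSq-> //.
by rewrite (eq_bigr (fun=> G (N g))) ?sumr_const ?cardnS // => v /NnS->.
Qed.

(** * The trace *)

Definition Fp_emb (F : finFieldType) (p : nat) (t : 'F_p) : F := (t : nat)%:R.
Arguments Fp_emb : clear implicits.

Definition frob (F : finFieldType) (p n : nat) (x : F) : F := x ^+ (p ^ n).
Arguments frob {F} p n x.

Section TraceTheory.

Variables (F : finFieldType) (p m : nat).
Hypotheses (p_pr : prime p) (cardF : #|F| = (p ^ m)%N).

Let charF : p \in [pchar F] := card_finPcharP cardF p_pr.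
Let e := Fp_emb F p.

Lemma dim_gt0 : (0 < m)%N.
Proof. by have := card_finRing_gt1 F; rewrite cardF; case: (m). Qed.

Lemma Fp_embD (s t : 'F_p) : e (s + t) = e s + e t.
Proof.
rewrite /e /Fp_emb -natrD -[RHS](GRing.natr_mod_pchar charF).
by congr (_ %% _)%:R; apply: Fp_cast.
Qed.

Lemma Fp_embM (s t : 'F_p) : e (s * t) = e s * e t.
Proof.
rewrite /e /Fp_emb -natrM -[RHS](GRing.natr_mod_pchar charF).
by congr (_ %% _)%:R; apply: Fp_cast.
Qed.

Lemma Fp_emb0 : e 0 = 0. Proof. by []. Qed.

Lemma Fp_emb1 : e 1 = 1.
Proof. by []. Qed.

Lemma Fp_emb_inj : injective e.
Proof. exact: (Fp_embed_inj p_pr cardF). Qed.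

Lemma Fp_emb_eq0 (t : 'F_p) : (e t == 0) = (t == 0).
Proof. by rewrite -Fp_emb0 (inj_eq Fp_emb_inj). Qed.

Lemma frobD n : {morph @frob F p n : x y / x + y}.
Proof.
by move=> x y; rewrite /frob exprDn_pchar // pnatX pnatE ?charF ?orbT.
Qed.

Lemma frobM n : {morph @frob F p n : x y / x * y}.
Proof. by move=> x y; rewrite /frob exprMn. Qed.

Lemma frob0 n : frob p n (0 : F) = 0.
Proof. by rewrite /frob expr0n expn_eq0 eqn0Ngt prime_gt0. Qed.

Lemma frobN n : {morph @frob F p n : x / - x}.
Proof.
by move=> x; apply/eqP; rewrite -subr_eq0 opprK -frobD addNr frob0.
Qed.

Lemma frob_frob k n (x : F) : frob p n (frob p k x) = frob p (k + n) x.
Proof. by rewrite /frob -exprM expnD. Qed.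

Lemma frob_id k (x : F) : frob p (k * m) x = x.
Proof.
elim: k => [|k IHk]; first by rewrite mul0n /frob expr1.
by rewrite mulSn -frob_frob {2}/frob -cardF expf_card.
Qed.

Lemma frob_inj n : injective (@frob F p n).
Proof.
apply: (can_inj (g := frob p (n * m.-1))) => x.
by rewrite frob_frob -mulnS prednK ?dim_gt0 // frob_id.
Qed.

Lemma frob_emb n t : frob p n (e t) = e t.
Proof.
elim: n => [|n IHn]; first by rewrite /frob expr1.
rewrite -addn1 -frob_frob IHn /frob expn1 /e /Fp_emb.
by rewrite -(pFrobenius_autE charF) pFrobenius_aut_nat.
Qed.

(** Coprimality gives [u * m = v * l + 1], so a fixed point satisfies [x ^ p = x]; the polynomial
    [X ^ p - X] already has the [p] elements of the prime field as roots. *)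
Lemma frob_fixP l (x : F) : gcdn m l = 1%N ->
  reflect (exists t, x = e t) (frob p l x == x).
Proof.
move=> co_ml; apply: (iffP eqP) => [xl|[t ->]]; last exact: frob_emb.
have xp : x ^+ p = x.
  have [u v] := egcdnP l dim_gt0; rewrite co_ml => uv _.
  have <- : frob p 1 x = x ^+ p by rewrite /frob expn1.
  have vl k : frob p (k * l) x = x.
    by elim: k => [|k IHk]; rewrite ?mulSn -?frob_frob ?xl // /frob expr1.
  by rewrite -[in LHS](vl v) frob_frob -uv frob_id.
have [t /eqP xt|no_t] := pickP (fun t => x == e t); first by exists t.
pose rs := x :: [seq e t | t : 'F_p].
pose P : {poly F} := 'X^p - 'X.
have sP : size P = p.+1.
  by rewrite size_addl ?size_polyXn // size_opp size_polyX ltnS prime_gt1.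
have P0 : P != 0 by rewrite -size_poly_gt0 sP.
have Prs : all (root P) rs.
  apply/allP=> y; rewrite inE => /orP[/eqP->|/mapP[t _ ->]].
    by rewrite /root /P !hornerE xp subrr.
  rewrite /root /P !hornerE.
  by have := frob_emb 1 t; rewrite /frob expn1 => ->; rewrite subrr.
have Urs : uniq rs.
  rewrite /rs cons_uniq map_inj_uniq ?enum_uniq ?andbT; last exact: Fp_emb_inj.
  by apply/negP=> /mapP[t _ xt]; have := no_t t; rewrite xt eqxx.
have := max_poly_roots P0 Prs Urs.
by rewrite /= size_map -cardE card_Fp // sP ltnn.
Qed.

Lemma card_frob_fix l : gcdn m l = 1%N ->
  #|[set x : F | frob p l x == x]| = p.
Proof.
move=> co_ml; have -> : [set x : F | frob p l x == x] = e @: setT.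
  apply/setP=> x; rewrite inE; apply/(frob_fixP _ co_ml)/imsetP => [[t ->]|[t _ ->]].
    by exists t.
  by exists t.
by rewrite card_imset ?cardsT ?card_Fp //; apply: Fp_emb_inj.
Qed.

Let Tr_e (x : F) : e (Tr p m x) = \sum_(i < m) frob p i x.
Proof. exact: (Tr_embed p_pr cardF). Qed.

Lemma TrD : {morph @Tr F p m : x y / x + y}.
Proof.
move=> x y; apply: Fp_emb_inj; rewrite Fp_embD !Tr_e -big_split.
by apply: eq_bigr => i _; rewrite frobD.
Qed.

Lemma TrZ t (x : F) : Tr p m (e t * x) = t * Tr p m x.
Proof.
apply: Fp_emb_inj; rewrite Fp_embM !Tr_e mulr_sumr.
by apply: eq_bigr => i _; rewrite frobM frob_emb.
Qed.

Lemma Tr0 : Tr p m (0 : F) = 0.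
Proof. by rewrite -(mul0r (0 : F)) -Fp_emb0 TrZ mul0r. Qed.

Lemma TrN : {morph @Tr F p m : x / - x}.
Proof.
by move=> x; apply/eqP; rewrite -subr_eq0 opprK -TrD addNr Tr0.
Qed.

Lemma Tr_frob n (x : F) : Tr p m (frob p n x) = Tr p m x.
Proof.
elim: n => [|n IHn]; first by rewrite /frob expr1.
rewrite -{}IHn -[n.+1]addn1 -frob_frob; move: (frob p n x) => y.
apply: Fp_emb_inj; rewrite !Tr_e; have := frob_id 1 y; rewrite mul1n.
case: m dim_gt0 => // k _ yk; rewrite big_ord_recr big_ord_recl addrC /=.
rewrite frob_frob add1n yk; congr (_ + _).
by apply: eq_bigr => i _; rewrite frob_frob.
Qed.

Lemma Tr_nontrivial : exists x : F, Tr p m x != 0.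
Proof.
have [x Tx|no_x] := pickP (fun x : F => Tr p m x != 0); first by exists x.
pose P : {poly F} := \sum_(i < m) 'X^(p ^ i).
have m1 : m = m.-1.+1 by rewrite prednK ?dim_gt0.
have sP : size P = (p ^ m.-1).+1.
  rewrite /P; have: (0 < m)%N := dim_gt0; case: (m) => // k _ /=.
  rewrite big_ord_recr /= addrC size_addl size_polyXn // ltnS.
  apply: (leq_trans (size_sum _ _ _)); apply/bigmax_leqP=> i _.
  by rewrite size_polyXn ltn_exp2l ?prime_gt1.
have P0 : P != 0 by rewrite -size_poly_gt0 sP.
have Prs : all (root P) (enum F).
  apply/allP=> x _; rewrite /root horner_sum.
  have /eqP := negbFE (no_x x); move/(congr1 e); rewrite Tr_e Fp_emb0 => Tx.
  by rewrite -[X in _ == X]Tx; apply/eqP/eq_bigr => i _; rewrite hornerXn.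
have := max_poly_roots P0 Prs (enum_uniq F); rewrite -cardE cardF sP ltnS.
by rewrite leq_exp2l ?prime_gt1 // {1}m1 ltnn.
Qed.

Lemma Tr_nondegenerate (c : F) : (forall x, Tr p m (c * x) = 0) -> c = 0.
Proof.
move=> Tc; apply/eqP/negP=> /negP c0; have [x /eqP[]] := Tr_nontrivial.
by rewrite -[x](mulVKf c0).
Qed.

End TraceTheory.

(** * Quadratic forms *)

Section QuadraticForms.

Variables (F : finFieldType) (p m l : nat).

Definition qform (a b x : F) : 'F_p :=
  Tr p m (a * x ^+ (p ^ l + 1) + b * x ^+ 2).

(* [frob p (l * m.-1)] is the inverse of [frob p l], so [polar a b x] represents
   the linear form [Q (x + y) - Q x - Q y] in [y] through the trace. *)
Definition polar (a b x : F) : F :=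
  a * frob p l x + frob p (l * m.-1) (a * x) + 2%:R * b * x.

Definition radical (a b : F) : {set F} := [set x | polar a b x == 0].

Definition level (a b : F) (v : 'F_p) : nat := #|[set x | qform a b x == v]|.

Definition zeros (a b c : F) (h : 'F_p) : nat :=
  #|[set x | codeword m l a b c h x == 0]|.

End QuadraticForms.

Arguments qform {F} p m l a b x.
Arguments polar {F} p m l a b x.
Arguments radical {F} p m l a b.
Arguments level {F} p m l a b v.
Arguments zeros {F} p m l a b c h.

Section QuadraticFormTheory.

Variables (F : finFieldType) (p m l : nat).
Hypotheses (p_pr : prime p) (p_odd : odd p) (cardF : #|F| = (p ^ m)%N).

Let charF : p \in [pchar F] := card_finPcharP cardF p_pr.
Local Notation e := (Fp_emb F p).
Local Notation q := ((p ^ m)%N).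
Local Notation sig := (@frob F p l).
Local Notation tau := (@frob F p (l * m.-1)).
Local Notation Tr := (@Defs.Tr F p m).
Local Notation Q := (@qform F p m l).
Local Notation L := (@polar F p m l).
Local Notation K := (@radical F p m l).
Local Notation N := (@level F p m l).

Lemma two_neq0F : 2%:R != 0 :> F.
Proof. by rewrite -(dvdn_pcharf charF) gtnNdvd ?odd_prime_gt2. Qed.

Lemma two_neq0Fp : 2%:R != 0 :> 'F_p.
Proof. by rewrite -(dvdn_pcharf (pchar_Fp p_pr)) gtnNdvd ?odd_prime_gt2. Qed.

Lemma frobK : cancel sig tau.
Proof.
move=> x; rewrite frob_frob -mulnS prednK ?(dim_gt0 cardF) //.
by rewrite (frob_id cardF).
Qed.

Lemma frobVK : cancel tau sig.
Proof. by move=> x; apply: (frob_inj cardF (n := l * m.-1)); apply: frobK. Qed.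

Lemma expr_frobS (x : F) : x ^+ (p ^ l + 1) = sig x * x.
Proof. by rewrite exprD expr1. Qed.

Lemma qformE a b x : Q a b x = Tr (a * (sig x * x) + b * x ^+ 2).
Proof. by rewrite /qform expr_frobS. Qed.

Lemma polarD a b : {morph L a b : x y / x + y}.
Proof.
move=> x y; rewrite /polar mulrDr !(frobD p_pr cardF).
by ring.
Qed.

Lemma qformD a b x y : Q a b (x + y) = Q a b x + Q a b y + Tr (L a b x * y).
Proof.
rewrite !qformE /polar !mulrDl !(TrD p_pr cardF).
(* The trace is invariant under [frob p l], which cancels [frob p (l * m.-1)]: the latter is the
   adjoint of [frob p l] for the trace form. *)
have -> : Tr (frob p (l * m.-1) (a * x) * y) = Tr (a * x * sig y).
  rewrite -[LHS](Tr_frob p_pr cardF l) frobM; congr (Tr (_ * _)).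
  exact: frobVK.
rewrite -!(TrD p_pr cardF) (frobD p_pr cardF); congr (Defs.Tr _ _ _).
by ring.
Qed.

Lemma polar_sym a b x y : Tr (L a b x * y) = Tr (L a b y * x).
Proof.
apply: (addrI (Q a b x + Q a b y)); rewrite -qformD addrC qformD.
by rewrite [X in X + _]addrC.
Qed.

Lemma polar0 a b : L a b 0 = 0.
Proof. by apply: (addrI (L a b 0)); rewrite -polarD !addr0. Qed.

Lemma polarN a b : {morph L a b : x / - x}.
Proof.
by move=> x; apply/eqP; rewrite -subr_eq0 opprK -polarD addNr polar0.
Qed.

Lemma polarZ a b t : {morph L a b : x / e t * x}.
Proof.
move=> x; rewrite /polar !mulrDr mulrCA !frobM !(frob_emb p_pr cardF).
by ring.
Qed.

Lemma qformZ a b t x : Q a b (e t * x) = t ^+ 2 * Q a b x.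
Proof.
rewrite !qformE frobM (frob_emb p_pr cardF) [t ^+ 2]expr2 -[t * t * _]mulrA.
rewrite -!(TrZ p_pr cardF); congr (Defs.Tr _ _ _).
by ring.
Qed.

Lemma qformN a b x : Q a b (- x) = Q a b x.
Proof.
have eN1 : e (- 1) = -1.
  apply/eqP; rewrite -subr_eq0 opprK -(Fp_emb1 F p) -(Fp_embD p_pr cardF).
  by rewrite addNr.
by rewrite -mulN1r -eN1 qformZ sqrrN expr1n mul1r.
Qed.

Lemma radicalD a b x y : x \in K a b -> y \in K a b -> x + y \in K a b.
Proof. by rewrite !inE polarD => /eqP-> /eqP->; rewrite addr0. Qed.

Lemma radicalZ a b t x : x \in K a b -> e t * x \in K a b.
Proof. by rewrite !inE polarZ => /eqP->; rewrite mulr0. Qed.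

Lemma radical0 a b : 0 \in K a b.
Proof. by rewrite inE polar0. Qed.

Lemma qform0 a b : Q a b 0 = 0.
Proof. by rewrite qformE expr0n /= !mulr0 addr0 (Tr0 p_pr cardF). Qed.

(** Evenness of [Q] turns [Q (x - x) = 0] into [2 * Q x = 0], and [p] is odd. *)
Lemma qform_radical a b x : x \in K a b -> Q a b x = 0.
Proof.
move=> /[dup] Kx; rewrite inE => /eqP Lx.
have := qformD a b x (- x); rewrite subrr qform0 qformN Lx mul0r.
rewrite (Tr0 p_pr cardF) addr0 => /esym/eqP.
by rewrite -mulr2n -mulr_natl mulf_eq0 (negPf two_neq0Fp) => /eqP.
Qed.

(** Stability of [D] under the single line through [r] suffices, so the lemma applies to the whole
    field as well as to a radical. *)
Lemma card_Tr_fibre (D : {set F}) (c r : F) v :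
    (forall x t, x \in D -> x + e t * r \in D) -> Tr (c * r) != 0 ->
  (p * #|[set x in D | Tr (c * x)%R == v]|)%N = #|D|.
Proof.
move=> DD cr; pose s t x := x + e (t / Tr (c * r)) * r.
apply: (card_equidistributed (s := s)) => // [t x y|t x Dx|t x Dx].
- exact: addIr.
- exact: DD.
by rewrite /s mulrDr mulrCA (TrD p_pr cardF) (TrZ p_pr cardF) mulfVK.
Qed.

Lemma level_sqr a b t v : t != 0 -> N a b (t ^+ 2 * v) = N a b v.
Proof.
move=> t0; have et0 : e t != 0 by rewrite (Fp_emb_eq0 p_pr cardF).
rewrite /level -[RHS](card_imset _ (mulfI et0)); apply/eq_card=> x.
rewrite inE; apply/eqP/imsetP => [Qx|[y /[!inE] /eqP Qy ->]]; last first.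
  by rewrite qformZ Qy.
exists (e t^-1 * x); last first.
  by rewrite mulrA -(Fp_embM p_pr cardF) divff // (Fp_emb1 F p) mul1r.
by rewrite inE qformZ Qx exprVn mulKf // expf_neq0.
Qed.

Lemma level_even a b v : v != 0 -> exists n, N a b v = (2 * n)%N.
Proof.
move=> v0; eexists; apply: card_symmetric; first exact: two_neq0F.
  by move=> y; rewrite !inE qformN.
by rewrite inE qform0 eq_sym.
Qed.

Lemma sum_level a b : (\sum_v N a b v)%N = q.
Proof.
rewrite -cardF -sum1_card (partition_big (Q a b) xpredT) //=.
by apply: eq_bigr => v _; rewrite sum1dep_card.
Qed.

(** The second moment counts pairs with equal value, regrouped by their difference [x]: a difference
    in the radical gives [q] pairs, any other one imposes a nontrivial affine condition and gives
    [q / p]. The terms are arranged to avoid subtraction in [nat]. *)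
Lemma sum_sqr_level a b :
  (p * (\sum_v N a b v ^ 2) + q * #|K a b| = q ^ 2 + p * q * #|K a b|)%N.
Proof.
have -> : (\sum_v N a b v ^ 2 = \sum_x #|[set y | Q a b (y + x)%R == Q a b y]|)%N.
  transitivity (\sum_y N a b (Q a b y))%N.
    rewrite [RHS](partition_big (Q a b) xpredT) //=; apply: eq_bigr => v _.
    rewrite (eq_bigr (fun=> N a b v)) => [|y /eqP-> //].
    by rewrite sum_nat_const mulnC expnS expn1 /level cardsE.
  transitivity (\sum_y \sum_x (Q a b (y + x)%R == Q a b y : nat))%N.
    apply: eq_bigr => y _; rewrite (reindex_inj (addrI (- y))) /=.
    rewrite /level -sum1dep_card big_mkcond /=; apply: eq_bigr => x _.
    by rewrite addNKr; case: (_ == _).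
  rewrite exchange_big; apply: eq_bigr => x _.
  by rewrite -sum1dep_card [RHS]big_mkcond; apply: eq_bigr => y _; case: (_ == _).
have part x : (p * #|[set y | Q a b (y + x)%R == Q a b y]| =
               if x \in K a b then p * q else q)%N.
  have [Kx|] := boolP (x \in K a b).
    rewrite (_ : [set y | _] = setT) ?cardsT ?cardF //.
    apply/setP=> y; rewrite !inE qformD (qform_radical Kx) addr0 polar_sym.
    by move: Kx; rewrite inE => /eqP->; rewrite mul0r (Tr0 p_pr cardF) addr0 eqxx.
  rewrite inE => Lx; have [r Lr] : exists r, Tr (L a b x * r) != 0.
    have [r Lr|no_r] := pickP (fun r => Tr (L a b x * r) != 0); first by exists r.
    case/eqP: Lx; apply: (Tr_nondegenerate p_pr cardF) => r.
    exact/eqP/(negbFE (no_r r)).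
  rewrite -cardF -cardsT.
  rewrite -(@card_Tr_fibre setT (L a b x) r (- Q a b x)) => [|? ? _|//]; rewrite ?inE //.
  congr (p * _)%N; apply/eq_card => y; rewrite !inE qformD polar_sym.
  by rewrite -addrA -[X in _ == X]addr0 (inj_eq (addrI _)) addrC -addr_eq0.
rewrite big_distrr /= (eq_bigr (fun x => q + if x \in K a b then p.-1 * q else 0)%N).
  rewrite big_split sum_nat_const -big_mkcond sum_nat_const cardF.
  move: #|_| q (prime_gt0 p_pr) => R n; case: (p) => // k _ /=; ring.
move=> x _; rewrite part; case: ifP => _; last by rewrite addn0.
by rewrite -mulSn prednK ?prime_gt0.
Qed.

Lemma card_polar_image a b : q = (#|K a b| * #|L a b @: setT|)%N.
Proof.
rewrite -cardF -cardsT; apply: card_regular_fibres => x _.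
rewrite -[RHS](card_imset _ (addIr x)); apply/eq_card => y; rewrite !inE /=.
apply/eqP/imsetP => [Lxy|[z + ->]]; last by rewrite inE polarD => /eqP->; rewrite add0r.
by exists (y - x); rewrite ?subrK // inE polarD polarN Lxy subrr.
Qed.

Lemma radical_gt0 a b : (0 < #|K a b|)%N.
Proof. by apply/card_gt0P; exists 0; apply: radical0. Qed.

(** Double counting of the pairs [(c, r)] with [r] in the radical and [Tr (c * r) = 0]: a [c]
    outside the set kills a [1 / p] part of the radical, and an [r != 0] is killed by a [1 / p] part
    of all [c]. *)
Lemma card_orth_radical a b :
  (#|[set c | [forall r in K a b, (Tr (c * r) == 0)%R]]| * #|K a b|)%N = q.
Proof.
set O := [set c | _].
have E : (p * (\sum_c \sum_(r in K a b) (Tr (c * r) == 0)%R) =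
          p * #|O| * #|K a b| + #|~: O| * #|K a b|)%N.
  rewrite (bigID [in O]) mulnDr /=; congr (_ + _)%N.
    rewrite (eq_bigr (fun=> #|K a b|)) => [|c].
      by rewrite sum_nat_const mulnA.
    rewrite inE => /forall_inP cK; rewrite -[RHS]sum1_card.
    by apply: eq_bigr => r /cK->.
  rewrite big_distrr -sum_nat_const /=; apply: eq_big => [c|c cO].
    by rewrite in_setC.
  have [r Kr cr] : exists2 r, r \in K a b & Tr (c * r) != 0.
    by apply/exists_inP; rewrite -negb_forall_in; rewrite inE in cO.
  rewrite -(@card_Tr_fibre (K a b) c r 0) //; last first.
    by move=> x t Kx; rewrite radicalD ?radicalZ.
  congr (p * _)%N; rewrite -sum1dep_card big_mkcondr.
  by apply: eq_bigr => x _; case: (_ == _).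
have E' : (p * (\sum_c \sum_(r in K a b) (Tr (c * r) == 0)%R) =
          p * q + #|K a b|.-1 * q)%N.
  rewrite exchange_big (bigD1 0) ?radical0 // mulnDr; congr (_ + _)%N.
    rewrite (eq_bigr (fun=> 1%N)) ?sum1_card ?cardF // => c _.
    by rewrite mulr0 (Tr0 p_pr cardF) eqxx.
  rewrite (cardD1 0) radical0 /= big_distrr -sum_nat_const /=.
  apply: eq_big => [r|r /andP[_ r0]]; first by rewrite !inE andbC.
  have [x Tx] := Tr_nontrivial p_pr cardF.
  rewrite -cardF -cardsT -(@card_Tr_fibre setT r (x / r) 0) => [|? ? _|]; rewrite ?inE //.
    congr (p * _)%N; rewrite -sum1dep_card [RHS]big_mkcond.
    by apply: eq_bigr => c _; rewrite in_setT mulrC /=; case: (_ == _).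
  by rewrite mulrC divfK.
have := cardsC O; rewrite cardF; have := radical_gt0 a b; have := prime_gt1 p_pr.
by move: E E'; nia.
Qed.

(** Symmetry of the polar form gives one inclusion, and the cardinalities force equality. It is the
    dichotomy for linear terms: absorbed by a translation, or nontrivial on the radical. *)
Lemma polar_imageP a b c :
  reflect (exists y, c = L a b y) [forall r in K a b, Tr (c * r) == 0].
Proof.
suff imE : L a b @: setT = [set c | [forall r in K a b, Tr (c * r) == 0]].
  have -> : [forall r in K a b, Tr (c * r) == 0] = (c \in L a b @: setT).
    by rewrite imE inE.
  by apply: (iffP imsetP) => [[y _ ->]|[y ->]]; exists y.
apply/eqP; rewrite eqEcard; apply/andP; split.
  apply/subsetP=> _ /imsetP[y _ ->]; rewrite inE; apply/forall_inP=> r.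
  by rewrite inE polar_sym => /eqP->; rewrite mul0r (Tr0 p_pr cardF).
rewrite -(leq_pmul2r (radical_gt0 a b)) card_orth_radical.
by rewrite {1}(card_polar_image a b) mulnC.
Qed.

Lemma codewordE a b c h x : codeword m l a b c h x = Q a b x + Tr (c * x) + h.
Proof. by rewrite ffunE /qform !(TrD p_pr cardF). Qed.

(** Completing the square: for [c = L a b y] the word takes at [x] the value
    [Q (x + y) - Q y + h]. *)
Lemma zeros_polar a b y h : zeros p m l a b (L a b y) h = N a b (Q a b y - h).
Proof.
rewrite /zeros /level -[LHS](card_imset _ (addIr y)); apply/eq_card=> x.
rewrite inE; apply/imsetP/eqP => [[z + ->]|Qx].
  rewrite inE codewordE qformD polar_sym => /eqP Qz.
  by apply/eqP; rewrite -subr_eq0 -Qz; apply/eqP; ring.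
exists (x - y); last by rewrite subrK.
rewrite inE codewordE; have := qformD a b (x - y) y.
rewrite subrK Qx polar_sym => H; rewrite -(subrr (Q a b y - h)) {1}H.
by apply/eqP; ring.
Qed.

(** Along some [r] in the radical with [Tr (c * r) != 0], the quadratic part is constant while the
    linear part takes every value equally often. *)
Lemma zeros_not_polar a b c h : ~ (exists y, c = L a b y) ->
  (p * zeros p m l a b c h)%N = q.
Proof.
move/polar_imageP; rewrite negb_forall_in => /exists_inP[r Kr cr].
pose s t x := x + e (t / Tr (c * r)) * r.
rewrite -cardF -cardsT /zeros.
rewrite -(@card_equidistributed _ p setT (codeword m l a b c h) s p_pr _ _ _ 0) //.
- by congr (p * _)%N; apply/eq_card=> x; rewrite !inE.
- by move=> t x y /addIr.
move=> t x _; rewrite !codewordE qformD (qform_radical (radicalZ _ Kr)) polar_sym.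
rewrite polarZ; move: (Kr); rewrite inE => /eqP->; rewrite mulr0 mul0r (Tr0 p_pr cardF).
rewrite mulrDr mulrCA (TrD p_pr cardF) (TrZ p_pr cardF) mulfVK //.
by ring.
Qed.

End QuadraticFormTheory.

(* The average over t in F_p^* of the character sums sum_x zeta ^ (t * Q x). *)
Definition gsum (F : finFieldType) (p m l : nat) (a b : F) : rat :=
  (p%:R * (level p m l a b 0)%:R - (p ^ m)%:R) / (p%:R - 1).
Arguments gsum {F} p m l a b.

(** * Level sizes of a quadratic form *)

Section Levels.

Variables (F : finFieldType) (p m l : nat).
Hypotheses (p_pr : prime p) (p_odd : odd p) (cardF : #|F| = (p ^ m)%N).

Local Notation q := (p ^ m)%N.
Local Notation P := (p%:R : rat).
Local Notation K := (@radical F p m l).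
Local Notation N := (@level F p m l).
Local Notation g := (@gsum F p m l).

Lemma ratp_gt2 : 2%:R < P.
Proof. by rewrite ltr_nat odd_prime_gt2. Qed.

Lemma level0E a b : (N a b 0)%:R = (q%:R + (P - 1) * g a b) / P.
Proof. by have := ratp_gt2; rewrite /gsum => ?; field; lra. Qed.

(* With T := N 0 - (N u + N w) / 2 and d := (N u - N w) / 2, which are integers
   because x |-> - x acts freely on the nonzero levels, the second moment of the
   levels reads T ^ 2 + p * d ^ 2 = q * #|K|. *)
Lemma level_dichotomy a b j : #|K a b| = (p ^ j)%N ->
  let s : rat := (p ^ (m + j)./2)%:R in
  if odd (m + j) then
    g a b = 0 /\ exists u w : 'F_p,
      [/\ (N a b u)%:R = q%:R / P + s, (N a b w)%:R = q%:R / P - s,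
          forall v : 'F_p, v != 0 -> N a b v = N a b u \/ N a b v = N a b w &
          forall (M : nmodType) (G : nat -> M), \sum_v G (N a b v) =
            G (N a b 0) + (G (N a b u) + G (N a b w)) *+ p./2]
  else (g a b = s \/ g a b = - s) /\
       (forall v : 'F_p, v != 0 -> (N a b v)%:R = (q%:R - g a b) / P).
Proof.
move=> cK; have := sum_square_invariant p_pr p_odd (level_sqr l p_pr cardF a b).
case=> u [w [u0 w0 Nuw NG]].
have [nu Nu] := level_even l p_pr p_odd cardF a b u0.
have [nw Nw] := level_even l p_pr p_odd cardF a b w0.
pose h := p./2; have pE : p = (2 * h + 1)%N.
  by rewrite -[LHS]odd_double_half p_odd addnC mul2n.
have E1 : q%:Z = (N a b 0)%:Z + (nu%:Z + nw%:Z) * 2 * h%:Z.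
  rewrite -(sum_level l cardF a b) (big_morph _ PoszD (erefl 0%:Z)).
  by rewrite NG Nu Nw -mulr_natr -/h !PoszM natz; ring.
have E2 : p%:Z * ((N a b 0)%:Z ^+ 2 + (nu%:Z ^+ 2 + nw%:Z ^+ 2) * 4 * h%:Z)
      + q%:Z * (p ^ j)%:Z = q%:Z ^+ 2 + p%:Z * q%:Z * (p ^ j)%:Z.
  have := congr1 Posz (sum_sqr_level l p_pr p_odd cardF a b).
  rewrite cK !PoszD !PoszM (big_morph _ PoszD (erefl 0%:Z)).
  rewrite (NG _ (fun n => (n ^ 2)%:Z)) Nu Nw -mulr_natr -/h natz.
  by rewrite -!mulnn !PoszM expr2 => E; rewrite -E; ring.
pose T : int := (N a b 0)%:Z - nu%:Z - nw%:Z; pose d : int := nu%:Z - nw%:Z.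
have h_gt0 : (0 < h)%N by rewrite half_gt0 prime_gt1.
have TdZ : T ^+ 2 + p%:Z * d ^+ 2 = q%:Z * (p ^ j)%:Z.
  (* Variance identity: [p] times the second moment of the levels minus the square of the first is
     [(p - 1) * (T ^ 2 + p * d ^ 2)]; hence the factor [2 * h = p - 1]. *)
  apply: (@mulfI _ (2 * h)%:Z); first by rewrite eqz_nat muln_eq0 -lt0n h_gt0.
  have pZ : p%:Z = 2 * h%:Z + 1 by rewrite {1}pE PoszD PoszM.
  have : (2 * h)%:Z * (q%:Z * (p ^ j)%:Z) =
    p%:Z * ((N a b 0)%:Z ^+ 2 + (nu%:Z ^+ 2 + nw%:Z ^+ 2) * 4 * h%:Z) - q%:Z ^+ 2.
    by apply: (addIr (q%:Z * (p ^ j)%:Z)); rewrite addrAC E2 pZ PoszM; ring.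
  by move=> ->; rewrite E1 pZ PoszM /T /d; ring.
have Td : (`|T| ^ 2 + p * `|d| ^ 2 = p ^ (m + j))%N.
  apply/eqP; rewrite -eqz_nat -!mulnn PoszD !PoszM expnD PoszM -TdZ.
  by rewrite !abszE -!normrM -!expr2 !ger0_norm ?sqr_ge0.
have gE : g a b = T%:~R.
  have qR : q%:R = (N a b 0)%:R + (nu%:R + nw%:R) * 2%:R * h%:R :> rat.
    have := congr1 (fun z : int => z%:~R : rat) E1.
    by rewrite !(rmorphD, rmorphM) /= -!pmulrn.
  have hP : P = 2%:R * h%:R + 1 by rewrite {1}pE natrD natrM.
  have hQ : 0 < h%:R :> rat by rewrite ltr0n.
  rewrite /gsum qR hP /T !rmorphB /= -!pmulrn; field.
  move: hQ; clear -F m l p_pr p_odd cardF; lra.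
have P0 : P != 0 by have := ratp_gt2; clear -F m l p_pr p_odd cardF; lra.
have := sum_square_prime_multiple_eq_pow p_pr Td; rewrite /=.
have hP : P = 2%:R * h%:R + 1 by rewrite {1}pE natrD natrM.
case: ifP => odd_k [].
- move/eqP; rewrite absz_eq0 => /eqP T0 dE.
  have g0 : g a b = 0 by rewrite gE T0.
  split=> //; have N0 := level0E a b; rewrite g0 mulr0 addr0 in N0.
  have := congr1 (fun z : int => z%:~R : rat) T0.
  rewrite /T !rmorphB /= -!pmulrn => T0R.
  (* Only the absolute value of [d] is known. Its sign tells which class has the larger level, and
     [u], [w] are exchanged accordingly. *)
  have [dp|dn] : d = (p ^ (m + j)./2)%:Z \/ d = - (p ^ (m + j)./2)%:Z.
    by rewrite -dE abszE; case: (ger0P d) => _; [left|right]; rewrite ?opprK.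
  + have := congr1 (fun z : int => z%:~R : rat) dp.
    rewrite /d rmorphB /= -!pmulrn => dR.
    exists u, w; split=> //; rewrite -N0 ?Nu ?Nw natrM -dR;
      by move: T0R; clear -F m l p_pr p_odd cardF; lra.
  have := congr1 (fun z : int => z%:~R : rat) dn.
  rewrite /d rmorphB rmorphN /= -!pmulrn => dR.
  exists w, u; split=> [|||M G]; rewrite -?N0.
  + by rewrite Nw natrM; move: T0R dR; clear -F m l p_pr p_odd cardF; lra.
  + by rewrite Nu natrM; move: T0R dR; clear -F m l p_pr p_odd cardF; lra.
  + by move=> v /Nuw[]; [right|left].
  by rewrite NG [in RHS]addrC [X in X *+ _]addrC addrC.
move/eqP; rewrite absz_eq0 => /eqP d0 TE; split.
  rewrite gE pmulrn -TE abszE; case: (ger0P T) => _; first by left.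
  by right; rewrite rmorphN opprK.
have := congr1 (fun z : int => z%:~R : rat) d0.
rewrite /d rmorphB /= -!pmulrn => d0R v v0.
have qR : q%:R = (N a b 0)%:R + (nu%:R + nw%:R) * 2%:R * h%:R :> rat.
  have := congr1 (fun z : int => z%:~R : rat) E1.
  by rewrite !(rmorphD, rmorphM) /= -!pmulrn.
apply: (mulIf P0); rewrite divfK // gE /T !rmorphB /= -!pmulrn qR hP.
have nuw : nu%:R = nw%:R :> rat.
  by move: d0R; clear -F m l p_pr p_odd cardF; lra.
by rewrite nuw; case: (Nuw v v0) => ->; rewrite ?Nu ?Nw natrM ?nuw; ring.
Qed.

End Levels.

(** * Radicals and moments *)

Section Moments.

Variables (F : finFieldType) (p m l : nat).
Hypotheses (p_pr : prime p) (p_odd : odd p) (cardF : #|F| = (p ^ m)%N).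
Hypothesis co_ml : gcdn m l = 1%N.

Local Notation e := (Fp_emb F p).
Local Notation q := (p ^ m)%N.
Local Notation P := (p%:R : rat).
Local Notation sig := (@frob F p l).
Local Notation tau := (@frob F p (l * m.-1)).
Local Notation Tr := (@Defs.Tr F p m).
Local Notation Q := (@qform F p m l).
Local Notation K := (@radical F p m l).
Local Notation N := (@level F p m l).
Local Notation g := (@gsum F p m l).

(** The equation says that [y / x] is fixed by [frob p l], hence lies in the prime field: the
    Wronskian vanishes exactly under [F_p]-dependence. *)
Lemma frob_ratio_fixP (x y : F) : x != 0 ->
  reflect (exists t, y = e t * x) (sig x * y == sig y * x).
Proof.
move=> x0; have sx0 : sig x != 0 by rewrite expf_eq0 (negPf x0) andbF.
apply: (iffP eqP) => [xy|[t ->]]; last first.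
  by rewrite frobM (frob_emb p_pr cardF); ring.
have /(frob_fixP p_pr cardF _ co_ml)[t yx] : sig (y / x) == y / x.
  apply/eqP; apply: (mulIf sx0); rewrite -frobM divfK //.
  by apply: (mulIf x0); rewrite -xy; field.
by exists t; rewrite -yx divfK.
Qed.

Lemma card_Fp_line (x : F) : x != 0 -> #|[set y | sig x * y == sig y * x]| = p.
Proof.
move=> x0; have inj : injective (fun t => e t * x).
  by move=> s t /(mulIf x0)/(Fp_emb_inj p_pr cardF).
rewrite -[RHS](card_Fp p_pr) -cardsT -(card_imset _ inj); apply/eq_card=> y.
rewrite inE; apply/(frob_ratio_fixP _ x0)/imsetP => [[t ->]|[t _ ->]].
  by exists t.
by exists t.
Qed.

(* The Wronskian of two solutions of a self-adjoint second-order frob-difference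
   equation is constant, that is, fixed by frob. *)
Lemma radical_wronskian a b x y : x \in K a b -> y \in K a b ->
  sig (a * (sig x * y - sig y * x)) = a * (sig x * y - sig y * x).
Proof.
rewrite !inE => /eqP Lx /eqP Ly.
have E : a * (sig x * y - sig y * x) = tau (a * (sig x * y - sig y * x)).
  rewrite mulrBr (frobD p_pr cardF) (frobN p_pr cardF) !frobM.
  rewrite !(frobK l cardF) -mulrBr.
  have := congr2 (fun u v => u * y - v * x) Lx Ly.
  rewrite /= /polar !frobM => Lxy; apply/eqP; rewrite -subr_eq0; apply/eqP.
  transitivity (0 * y - 0 * x); last by rewrite !mul0r subr0.
  by rewrite -Lxy; ring.
by rewrite {1}E (frobVK l cardF).
Qed.

(** For [a != 0] and [x != 0] in the radical, the Wronskian with [x] is additive, is [F_p]-valued on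
    the radical and has the line through [x] as kernel, so there are at most [p * p] elements. For
    [a = 0] the radical is trivial. *)
Lemma card_radical_le a b : (a != 0) || (b != 0) -> (#|K a b| <= p ^ 2)%N.
Proof.
have [->|a0 _] := eqVneq a 0.
  rewrite orFb => b0; apply: (@leq_trans 1%N); last by rewrite expn_gt0 prime_gt0.
  rewrite -(cards1 (0 : F)); apply/subset_leq_card/subsetP=> x.
  rewrite !inE /polar !mul0r (frob0 F p_pr) !add0r !mulf_eq0 (negPf b0).
  by rewrite (negPf (two_neq0F p_pr p_odd cardF)).
have [x /andP[Kx x0]|no_x] := pickP (fun x => (x \in K a b) && (x != 0)); last first.
  apply: (@leq_trans 1%N); last by rewrite expn_gt0 prime_gt0.
  rewrite -(cards1 (0 : F)); apply/subset_leq_card/subsetP=> x Kx.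
  by rewrite inE; apply/negbFE; have := no_x x; rewrite Kx.
pose W y := a * (sig x * y - sig y * x).
rewrite (@card_regular_fibres _ _ (K a b) W p) => [|y Ky].
  rewrite leq_pmul2l ?prime_gt0 // -{2}(card_frob_fix p_pr cardF co_ml).
  apply/subset_leq_card/subsetP=> _ /imsetP[y Ky ->]; rewrite inE.
  exact/eqP/(radical_wronskian Kx Ky).
rewrite -{2}(card_Fp_line x0) -[RHS](card_imset _ (addIr y)); apply/eq_card=> z.
rewrite inE; apply/andP/imsetP => [[Kz /eqP Wzy]|[w]].
  exists (z - y); last by rewrite subrK.
  rewrite inE (frobD p_pr cardF) (frobN p_pr cardF) -subr_eq0.
  apply/eqP/(mulfI a0); rewrite mulr0 -(subrr (W y)) -{1}Wzy /W.
  by ring.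
rewrite inE => xw ->; move/(frob_ratio_fixP _ x0): (xw) => [t wE].
split; first by rewrite wE (radicalD p_pr cardF) ?(radicalZ p_pr cardF).
rewrite -subr_eq0 /W (frobD p_pr cardF); apply/eqP.
transitivity (a * (sig x * w - sig w * x)); first by ring.
by rewrite (eqP xw) subrr mulr0.
Qed.

Lemma card_radical a b : (a != 0) || (b != 0) ->
  [\/ #|K a b| = 1%N, #|K a b| = p | #|K a b| = (p ^ 2)%N].
Proof.
move/card_radical_le; have : (#|K a b| %| q)%N.
  by rewrite (card_polar_image l p_pr cardF a b) dvdn_mulr.
case/(dvdn_pfactor _ _ p_pr) => j _ ->.
rewrite leq_exp2l ?prime_gt1 //.
by case: j => [|[|[|]]] // _; [constructor 1 | constructor 2 | constructor 3].
Qed.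

Lemma radical00 : #|K 0 0| = q.
Proof.
rewrite -cardF -cardsT; apply/eq_card=> x; rewrite !inE /polar.
by rewrite !(mul0r, mulr0) (frob0 F p_pr) !addr0 eqxx.
Qed.

Lemma qform00 x : Q 0 0 x = 0.
Proof. by rewrite /qform !mul0r addr0 (Tr0 p_pr cardF). Qed.

Lemma gsum00 : g 0 0 = q%:R.
Proof.
rewrite /gsum (_ : N 0 0 0 = q).
  by have := ratp_gt2 p_pr p_odd => ?; field; lra.
by rewrite -cardF -cardsT; apply/eq_card=> x; rewrite !inE qform00 eqxx.
Qed.

(** The equation [polar a b x = 0] is linear in [b]; this is its solution for [x != 0]. *)
Definition radical_coef (x a : F) : F := - (a * sig x + tau (a * x)) / (2%:R * x).

Local Notation bof := radical_coef.

Lemma mem_radicalE x a b : x != 0 -> (x \in K a b) = (b == bof x a).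
Proof.
move=> x0; rewrite inE /polar /radical_coef.
have d0 : 2%:R * x != 0 by rewrite mulf_neq0 // (two_neq0F p_pr p_odd cardF).
rewrite -[RHS](inj_eq (mulIf d0)) divfK // -[RHS]subr_eq0 opprK.
by congr (_ == 0); ring.
Qed.

Lemma sum_mem_radical (M : nmodType) (f : F -> F -> M) x : x != 0 ->
  \sum_(ab : F * F | x \in K ab.1 ab.2) f ab.1 ab.2 = \sum_a f a (bof x a).
Proof.
move=> x0; rewrite -(pair_big_dep xpredT (fun a b => x \in K a b)) /=.
apply: eq_bigr => a _; rewrite (big_pred1 (bof x a)) // => b.
by rewrite mem_radicalE.
Qed.

Lemma sum_card_radical :
  (* Incidences of forms with vectors of their radical: [0] lies in all [q ^ 2] radicals, any other
     vector in one for each [a]. *)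
  (\sum_(ab : F * F) #|K ab.1 ab.2| = q ^ 2 + q.-1 * q)%N.
Proof.
transitivity (\sum_(ab : F * F) \sum_(x in K ab.1 ab.2) 1)%N.
  by apply: eq_bigr => ab _; rewrite sum1_card.
rewrite (exchange_big_dep xpredT) //= (bigD1 0) //=; congr (_ + _)%N.
  rewrite (eq_bigl xpredT) => [|ab]; last by rewrite (radical0 l p_pr cardF).
  by rewrite sum1_card card_prod cardF mulnn.
rewrite (eq_bigr (fun=> q)) => [|x x0]; last first.
  by rewrite (sum_mem_radical (fun _ _ => 1%N) x0) sum1_card cardF.
by rewrite sum_nat_const cardC1 cardF.
Qed.

(** Once [x] is in the radical, eliminating [b] between the equations of [x] and [y] is reversible,
    so a fixed Wronskian also suffices. For independent [x] and [y] this confines [a] to an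
    [F_p]-line. *)
Lemma mem_radical_coefE x y a : x != 0 ->
  (y \in K a (bof x a)) =
  (sig (a * (sig x * y - sig y * x)) == a * (sig x * y - sig y * x)).
Proof.
move=> x0; have Kx : x \in K a (bof x a) by rewrite mem_radicalE.
apply/idP/eqP => [Ky|]; first exact: radical_wronskian Kx Ky.
move/(congr1 tau); rewrite (frobK l cardF) mulrBr (frobD p_pr cardF).
rewrite (frobN p_pr cardF) !frobM !(frobK l cardF) => E.
rewrite inE; apply/eqP/(mulIf x0); rewrite mul0r.
have := Kx; rewrite inE => /eqP Lx; rewrite -(mul0r y) -Lx.
apply/eqP; rewrite -subr_eq0; move/eqP: E; rewrite -subr_eq0 -oppr_eq0.
by congr (_ == 0); rewrite /polar !frobM; ring.
Qed.

(** Both sides count forms together with an ordered [F_p]-independent pair in the radical; each of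
    the [(q - 1) * (q - p)] pairs belongs to [p] forms. Truncation in [#|K| - p] is harmless: a
    radical smaller than [p] has one element, and then the first factor is [0]. *)
Lemma sum_card_radical_pairs :
  (\sum_(ab : F * F) (#|K ab.1 ab.2|.-1 * (#|K ab.1 ab.2| - p)) =
   q.-1 * ((q - p) * p))%N.
Proof.
pose ind x := [set y | sig x * y != sig y * x].
have cind x : x != 0 -> #|ind x| = (q - p)%N.
  move=> x0; rewrite cardsCs cardF; congr (q - _)%N.
  by rewrite -[RHS](card_Fp_line x0); apply/eq_card=> y; rewrite !inE negbK.
transitivity (\sum_(ab : F * F) \sum_(x in K ab.1 ab.2 :\ 0%R)
                \sum_(y in ind x | y \in K ab.1 ab.2) 1)%N.
  apply: eq_bigr => -[a b] _ /=.
  have -> : #|K a b|.-1 = #|K a b :\ 0|.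
    by rewrite [in LHS](cardsD1 0) (radical0 l p_pr cardF).
  rewrite -sum_nat_const; apply: eq_bigr => x /setD1P[x0 Kx].
  have sub : [set y | sig x * y == sig y * x] \subset K a b.
    apply/subsetP=> y; rewrite inE => /(frob_ratio_fixP _ x0)[t ->].
    by rewrite (radicalZ p_pr cardF).
  have := cardsD (K a b) [set y | sig x * y == sig y * x].
  rewrite (setIidPr sub) (card_Fp_line x0) => <-.
  by rewrite sum1dep_card; apply/eq_card=> y; rewrite !inE.
under eq_bigr => ab _ do under eq_bigl => x do rewrite !inE.
rewrite (exchange_big_dep (fun x => x != 0)) /=; last first.
  by move=> ab x _ /andP[].
rewrite (eq_bigr (fun=> (q - p) * p)%N) => [|x x0].
  by rewrite sum_nat_const cardC1 cardF.
rewrite (eq_bigl (fun ab : F * F => x \in K ab.1 ab.2)) => [|ab]; last first.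
  by rewrite x0 inE.
rewrite (sum_mem_radical (fun a b => \sum_(y in ind x | y \in K a b) 1)%N x0).
rewrite (exchange_big_dep [in ind x]) /=; last by move=> a y _ /andP[].
rewrite -(cind x x0) -sum_nat_const; apply: eq_bigr => y yx.
have w0 : sig x * y - sig y * x != 0 by move: yx; rewrite inE subr_eq0.
rewrite -[RHS](card_frob_fix p_pr cardF co_ml) sum1dep_card.
rewrite -[LHS](card_imset _ (mulIf w0)); apply/eq_card=> z.
rewrite [RHS]inE; apply/imsetP/idP => [[a]|fz].
  by rewrite inE yx mem_radical_coefE // => + ->.
exists (z / (sig x * y - sig y * x)); last by rewrite divfK.
by rewrite in_set yx mem_radical_coefE // divfK.
Qed.


(** Under the trace [tau] disappears and a square completes. The result is linear in [a], with a
    coefficient vanishing exactly for [z] fixed by [frob p l], so summing over [a] becomes a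
    count. *)
Lemma qform_radical_coef x a z : x != 0 ->
  Q a (bof x a) (x * z) = Tr (a * (- (sig x * x * (sig z - z) ^+ 2) / 2%:R)).
Proof.
move=> x0; have two0 := two_neq0F p_pr p_odd cardF.
rewrite qformE !frobM.
transitivity (Tr (a * (sig x * sig z * (x * z) - sig x * x * z ^+ 2 / 2%:R)
              - tau (a * (sig x * x * (sig z * sig z)) / 2%:R))).
  congr (Tr _); rewrite /radical_coef !frobM !(frobK l cardF).
  have -> : tau 2%:R^-1 = 2%:R^-1 :> F.
    rewrite /frob exprVn; congr _^-1.
    by have := frobD p_pr cardF (l * m.-1) 1 1; rewrite /frob !expr1n.
  by field; rewrite two0 x0.
rewrite (TrD p_pr cardF) (TrN p_pr cardF) (Tr_frob p_pr cardF) -(TrN p_pr cardF).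
rewrite -(TrD p_pr cardF); congr (Tr _).
by field.
Qed.

Lemma card_Tr_eq0 (k : F) v : k != 0 -> (p * #|[set a | Tr (a * k)%R == v]|)%N = q.
Proof.
move=> k0; have [x Tx] := Tr_nontrivial p_pr cardF.
rewrite -cardF -cardsT -(@card_Tr_fibre F p m p_pr cardF setT k (x / k) v).
- by congr (p * _)%N; apply/eq_card=> y; rewrite !inE mulrC.
- by move=> *; rewrite inE.
by rewrite mulrC divfK.
Qed.

(** For fixed [a] and [x != 0] the value [Q a b x] is equidistributed as [b] varies; only [x = 0]
    departs from the mean. *)
Lemma sum_gsum : \sum_(ab : F * F) g ab.1 ab.2 = q%:R ^+ 2.
Proof.
have E : (p * \sum_(ab : F * F) N ab.1 ab.2 0%R = p * q ^ 2 + q.-1 * q ^ 2)%N.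
  transitivity (p * \sum_x \sum_a #|[set b | Q a b x == 0%R]|)%N.
    congr (p * _)%N; rewrite exchange_big -(pair_bigA _ (fun a b => N a b 0)) /=.
    apply: eq_bigr => a _; rewrite (eq_bigr (fun b => \sum_x (Q a b x == 0%R))%N).
      rewrite exchange_big; apply: eq_bigr => x _.
      by rewrite -sum1dep_card [RHS]big_mkcond; apply: eq_bigr => b _; case: (_ == _).
    move=> b _; rewrite /level -sum1dep_card big_mkcond.
    by apply: eq_bigr => x _; case: (_ == _).
  rewrite (bigD1 0) //= mulnDr; congr (_ + _)%N.
    rewrite (eq_bigr (fun=> q)) => [|a _]; first by rewrite sum_nat_const cardF.
    rewrite (_ : [set b | _] = setT) ?cardsT //; apply/setP=> b.
    by rewrite !inE (qform0 l p_pr cardF) eqxx.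
  rewrite big_distrr /= (eq_bigr (fun=> q ^ 2)%N) => [|x x0].
    by rewrite sum_nat_const cardC1 cardF.
  rewrite big_distrr /= (eq_bigr (fun=> q)) => [|a _].
    by rewrite sum_nat_const cardF.
  have x20 : x ^+ 2 != 0 by rewrite expf_neq0.
  rewrite -[RHS](card_Tr_eq0 (- Tr (a * x ^+ (p ^ l + 1))) x20).
  congr (p * _)%N; apply/eq_card=> b.
  by rewrite !inE /qform (TrD p_pr cardF) addrC addr_eq0.
have := congr1 (fun n => n%:R : rat) E.
rewrite -!mulnn !natrD !natrM natr_sum -subn1 natrB ?expn_gt0 ?prime_gt0 // => {E}ER.
have p2 := ratp_gt2 p_pr p_odd; have p1 : P - 1 != 0 by lra.
apply: (mulIf p1); rewrite mulr_suml (eq_bigr (fun ab => P * (N ab.1 ab.2 0)%:R - q%:R)).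
  rewrite sumrB -mulr_sumr ER sumr_const card_prod cardF -[q%:R *+ _]mulr_natr natrM.
  by ring.
by move=> ab _; rewrite /gsum divfK.
Qed.

(** With the argument written [x * z], the [p] fixed values of [z] give [0] for every [a], and every
    other [z] does so for a [1 / p] part of the [a]. *)
Lemma sum_gsum_radical_coef x : x != 0 -> \sum_a g a (bof x a) = q%:R * P.
Proof.
move=> x0; have E : (p * \sum_a N a (bof x a) 0%R = q * q + p.-1 * q * p)%N.
  transitivity (p * \sum_z #|[set a | Q a (bof x a) (x * z)%R == 0%R]|)%N.
    congr (p * _)%N; rewrite (eq_bigr (fun a => \sum_z (Q a (bof x a) (x * z)%R == 0%R))%N).
      rewrite exchange_big; apply: eq_bigr => z _.
      by rewrite -sum1dep_card [RHS]big_mkcond; apply: eq_bigr => b _; case: (_ == _).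
    move=> a _; rewrite /level -sum1dep_card big_mkcond (reindex_inj (mulfI x0)).
    by apply: eq_bigr => z _; case: (_ == _).
  rewrite big_distrr /= (eq_bigr (fun z => q + if sig z == z then p.-1 * q else 0)%N).
    rewrite big_split sum_nat_const -big_mkcond sum_nat_const cardF.
    congr (_ + _)%N; rewrite mulnC; congr (_ * _)%N.
    by rewrite -[RHS](card_frob_fix p_pr cardF co_ml) cardsE.
  move=> z _; under eq_finset => a do rewrite qform_radical_coef //.
  case: ifP => sz.
    rewrite (_ : [set a | _] = setT) ?cardsT ?cardF.
      by rewrite -mulSn prednK ?prime_gt0.
    apply/setP=> a; rewrite !inE (eqP sz) subrr expr0n /= mulr0 oppr0 mul0r mulr0.
    by rewrite (Tr0 p_pr cardF) eqxx.
  rewrite card_Tr_eq0 ?addn0 //.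
  rewrite mulf_neq0 ?invr_eq0 ?(two_neq0F p_pr p_odd cardF) // oppr_eq0.
  by rewrite mulf_neq0 ?expf_neq0 ?subr_eq0 ?sz // mulf_neq0 // expf_neq0.
have := congr1 (fun n => n%:R : rat) E.
rewrite !natrD !natrM natr_sum -subn1 natrB ?prime_gt0 // => {E}ER.
have p2 := ratp_gt2 p_pr p_odd; have p1 : P - 1 != 0 by lra.
apply: (mulIf p1); rewrite mulr_suml (eq_bigr (fun a => P * (N a (bof x a) 0)%:R - q%:R)).
  rewrite sumrB -mulr_sumr ER sumr_const cardF -[q%:R *+ _]mulr_natr.
  by ring.
by move=> ab _; rewrite /gsum divfK.
Qed.

Lemma sum_gsum_card_radical :
  \sum_(ab : F * F) g ab.1 ab.2 * #|K ab.1 ab.2|%:R =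
  q%:R ^+ 2 + (q%:R - 1) * (q%:R * P).
Proof.
transitivity (\sum_(ab : F * F) \sum_(x in K ab.1 ab.2) g ab.1 ab.2).
  by apply: eq_bigr => ab _; rewrite sumr_const mulr_natr.
rewrite (exchange_big_dep xpredT) //= (bigD1 0) //=; congr (_ + _).
  rewrite (eq_bigl xpredT) ?sum_gsum // => ab.
  by rewrite (radical0 l p_pr cardF).
rewrite (eq_bigr (fun=> q%:R * P)) => [|x x0]; last first.
  by rewrite (sum_mem_radical g x0) sum_gsum_radical_coef.
rewrite sumr_const cardC1 cardF -[_ *+ q.-1]mulr_natl -subn1 natrB //.
by rewrite expn_gt0 prime_gt0.
Qed.

End Moments.

(** * Designs from codes *)

Section AffineDesigns.

Variables (F : finFieldType) (B : {set {set F}}) (k : nat).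
Hypothesis cardB : forall b : {set F}, b \in B -> #|b| = k.
Hypothesis affB : forall (u v : F) (b : {set F}), u != 0 -> b \in B ->
  [set x | u * x + v \in b] \in B.

Let pair_deg (x y : F) := #|[set b in B | (x \in b) && (y \in b)]|.

Let pair_deg_le x1 y1 x2 y2 : x1 != y1 -> x2 != y2 ->
  (pair_deg x1 y1 <= pair_deg x2 y2)%N.
Proof.
move=> xy1 xy2; have d2 : x2 - y2 != 0 by rewrite subr_eq0.
(* The affine map with these coefficients sends [x2] to [x1] and [y2] to [y1], so preimages take
   blocks through the first pair to blocks through the second. *)
pose u := (x1 - y1) / (x2 - y2); pose v := x1 - u * x2.
have u0 : u != 0 by rewrite mulf_neq0 ?invr_eq0 ?subr_eq0.
have phix : u * x2 + v = x1 by rewrite /v addrC subrK.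
have phiy : u * y2 + v = y1 by rewrite /v /u; field.
pose phi (b : {set F}) := [set x | u * x + v \in b].
have phi_inj : injective phi.
  move=> b c /setP bc; apply/setP=> y; have := bc ((y - v) / u).
  by rewrite !inE mulrC divfK // subrK.
rewrite /pair_deg -(card_imset _ phi_inj); apply/subset_leq_card/subsetP.
move=> _ /imsetP[b /setIdP[Bb xyb] ->].
by rewrite !inE affB //= phix phiy.
Qed.

(** The second conjunct counts a block with two distinct points in it; it recovers [n] from the
    number of blocks. *)
Lemma affine_2_design : exists n, is_2_design #|F| k n B /\
  (#|F| * (#|F|.-1 * n) = #|B| * (k * k.-1))%N.
Proof.
have n01 : (0 : F) != 1 by rewrite eq_sym oner_eq0.
pose n := pair_deg 0 1.
have degE x y : x != y -> pair_deg x y = n.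
  by move=> xy; apply/eqP; rewrite eqn_leq !pair_deg_le.
exists n; split.
  split=> // T /eqP/cards2P[x [y [xy ->]]].
  rewrite -(degE x y xy); apply/eq_card=> b; rewrite !inE.
  by rewrite subUset !sub1set.
transitivity (\sum_x \sum_(y | y != x) \sum_(b in B | (x \in b) && (y \in b)) 1)%N.
  rewrite -sum_nat_const; apply: eq_bigr => x _.
  rewrite -(cardC1 x) -sum_nat_const; apply: eq_bigr => y yx.
  by rewrite -(degE x y) /pair_deg -?sum1dep_card // eq_sym.
transitivity (\sum_(b in B) \sum_(x in b) \sum_(y | (y != x) && (y \in b)) 1)%N.
  rewrite [RHS](exchange_big_dep xpredT) //=; apply: eq_bigr => x _.
  rewrite [LHS](exchange_big_dep (fun b => (b \in B) && (x \in b))) /=.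
    apply: eq_bigr => b /andP[Bb xb]; apply: eq_bigl => y.
    by rewrite Bb xb /= .
  by move=> y b _ /and3P[-> ->].
rewrite -sum_nat_const; apply: eq_bigr => b Bb.
rewrite -{1}(cardB Bb) -sum_nat_const; apply: eq_bigr => x xb.
rewrite sum1dep_card -(cardB Bb) [in RHS](cardsD1 x) xb /=.
by apply/eq_card=> y; rewrite !inE.
Qed.

End AffineDesigns.

(** * Codewords sharing a support *)

Section Supports.

Variables (I : finType) (K : finFieldType) (C : {set {ffun I -> K}}) (d k : nat).
Hypothesis scalC : forall (t : K) w, w \in C -> [ffun x => t * w x] \in C.
Hypothesis subC : forall w1 w2, w1 \in C -> w2 \in C ->
  [ffun x => w1 x - w2 x] \in C.
Hypothesis min_wt : forall w, w \in C -> w != [ffun=> 0] -> (d <= wt w)%N.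
Hypotheses (k_gt0 : (0 < k)%N) (k_small : (k * (#|K| - 2) < d * #|K|.-1)%N).

(* If w1 - t * w2 were nonzero for every t != 0, summing their weights over t
   would give d * (#|K| - 1) <= k * (#|K| - 2). *)
Lemma eq_supp_proportional w1 w2 : w1 \in C -> w2 \in C ->
    supp w1 = supp w2 -> wt w2 = k ->
  exists2 t, t != 0 & w1 = [ffun x => t * w2 x].
Proof.
move=> C1 C2 S12 wt2.
have [t /andP[t0 /eqP ->]|no_t] :=
  pickP (fun t => (t != 0) && (w1 == [ffun x => t * w2 x])); first by exists t.
have suppE x : (w1 x == 0) = (w2 x == 0).
  by have /setP/(_ x) := S12; rewrite !inE => /negb_inj.
have big (t : K) : t != 0 ->
    (d + #|[set x in supp w2 | w1 x == (t * w2 x)%R]| <= k)%N.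
  move=> t0; pose w := [ffun x => w1 x - [ffun x => t * w2 x] x].
  have Cw : w \in C by rewrite subC ?scalC.
  have w0 : w != [ffun=> 0].
    apply: contraFneq (no_t t) => /ffunP wE; rewrite t0; apply/eqP/ffunP=> x.
    by apply/eqP; rewrite -subr_eq0; have := wE x; rewrite !ffunE => ->.
  apply: (leq_trans (leq_add (min_wt Cw w0) (leqnn _))); rewrite -wt2 /wt.
  rewrite -cardsUI (_ : _ :&: _ = set0) ?cards0 ?addn0; last first.
    apply/setP=> x; rewrite !inE !ffunE subr_eq0.
    by case: (_ == t * _); rewrite ?andbF.
  apply/subset_leq_card/subsetP=> x; rewrite !inE !ffunE.
  case/orP=> [|/andP[//]]; apply: contraNneq => w2x.
  have /eqP-> : w1 x == 0 by rewrite suppE w2x.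
  by rewrite w2x mulr0 subr0.
(* Each point of the support has exactly one ratio [w1 x / w2 x], and it is nonzero, so the
   agreement sets partition the support. *)
have tot : (\sum_(t : K | t != 0%R) #|[set x in supp w2 | w1 x == (t * w2 x)%R]| = k)%N.
  rewrite -wt2 /wt -[RHS]sum1_card.
  rewrite [RHS](partition_big (fun x => w1 x / w2 x) (fun t => t != 0)) /=.
    apply: eq_bigr => t t0; rewrite -sum1dep_card; apply: eq_bigl => x.
    rewrite inE; have [//|w2x] := eqVneq (w2 x) 0.
    by rewrite /= -[RHS](inj_eq (mulIf w2x)) divfK.
  by move=> x; rewrite inE => w2x; rewrite mulf_neq0 ?invr_eq0 ?suppE.
have : (\sum_(t : K | t != 0%R) (d + #|[set x in supp w2 | w1 x == (t * w2 x)%R]|)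
         <= \sum_(t : K | t != 0%R) k)%N by apply: leq_sum.
rewrite big_split /= tot !sum_nat_const cardC1.
have := card_finRing_gt1 K; move: k_small.
case: #|K| => [|[|n]] //=; rewrite subn2 /=; nia.
Qed.

(** The words with a given support are the nonzero multiples of one of them; a point of the support,
    which exists because [k > 0], makes these multiples distinct. *)
Lemma num_wt_supports : num_wt C k = (#|K|.-1 * #|supports C k|)%N.
Proof.
rewrite /num_wt /supports; set D := [set w in C | _].
have -> : [set supp w | w in C & wt w == k] = @supp I K @: D.
  by apply/setP=> S; apply/imsetP/imsetP => -[w wD ->]; exists w; rewrite // !inE in wD *.
apply: card_regular_fibres => w /setIdP[Cw /eqP wtw].
have [x xS] : exists x, x \in supp w by apply/set0Pn; rewrite -card_gt0 -/(wt w) wtw.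
have wx : w x != 0 by rewrite inE in xS.
have inj : injective (fun t : K => [ffun y => t * w y]).
  by move=> s t /ffunP/(_ x); rewrite !ffunE => /(mulIf wx).
rewrite -(cardC1 (0 : K)) -cardsE -[RHS](card_imset _ inj); apply/eq_card=> w'.
apply/idP/imsetP => [|[t]].
  rewrite !inE => /andP[/andP[Cw' /eqP wtw'] /eqP S'].
  by have [t t0 ->] := eq_supp_proportional Cw' Cw S' wtw; exists t; rewrite ?inE.
rewrite !inE => t0 ->.
have St : supp [ffun y => t * w y] = supp w.
  by apply/setP=> y; rewrite !inE ffunE mulf_eq0 (negPf t0).
by rewrite scalC // /wt St -/(wt w) wtw !eqxx.
Qed.

End Supports.

(** * Zeros of codewords *)

Section CodeWeights.

Variables (F : finFieldType) (p m l r : nat).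
Hypotheses (p_pr : prime p) (p_odd : odd p) (cardF : #|F| = (p ^ m)%N).
Hypothesis co_ml : gcdn m l = 1%N.
Hypotheses (mE : m = (2 * r.+1)%N) (r_gt0 : (0 < r)%N).

Local Notation e := (Fp_emb F p).
Local Notation q := (p ^ m)%N.
Local Notation P := (p%:R : rat).
Local Notation t := (P ^+ r).
Local Notation Tr := (@Defs.Tr F p m).
Local Notation Q := (@qform F p m l).
Local Notation L := (@polar F p m l).
Local Notation K := (@radical F p m l).
Local Notation N := (@level F p m l).
Local Notation g := (@gsum F p m l).
Local Notation cw := (@codeword F p m l).
Local Notation C := (D1 F p m l).

Lemma mem_D1 a b c h : cw a b c h \in C.
Proof. by apply/imsetP; exists (a, b, c, h). Qed.

Lemma D1_scale (k : 'F_p) w : w \in C -> [ffun x => k * w x] \in C.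
Proof.
case/imsetP=> -[[[a b] c] h] _ ->; apply/imsetP.
exists (e k * a, e k * b, e k * c, k * h) => //; apply/ffunP=> x.
rewrite !ffunE /= mulrDr -(TrZ p_pr cardF); congr (Tr _ + _).
by rewrite !mulrDr !mulrA.
Qed.

Lemma D1_sub w1 w2 : w1 \in C -> w2 \in C -> [ffun x => w1 x - w2 x] \in C.
Proof.
case/imsetP=> -[[[a b] c] h] _ -> /imsetP[[[[a' b'] c'] h'] _ ->]; apply/imsetP.
exists (a - a', b - b', c - c', h - h') => //; apply/ffunP=> x.
rewrite !ffunE /= opprD addrACA -(TrN p_pr cardF) -(TrD p_pr cardF).
by congr (Tr _ + _); ring.
Qed.

(** The translation contributes [Tr (L a b v * (u * x))], again a linear term, and a constant; the
    homothety only rescales coefficients. *)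
Lemma D1_affine (u v : F) w : w \in C -> [ffun x => w (u * x + v)] \in C.
Proof.
case/imsetP=> -[[[a b] c] h] _ ->; apply/imsetP.
exists (a * (frob p l u * u), b * u ^+ 2, L a b v * u + c * u,
        Q a b v + Tr (c * v) + h) => //; apply/ffunP=> x.
rewrite ffunE !(codewordE l p_pr cardF) (qformD l p_pr cardF) polar_sym //.
have -> : Q a b (u * x) = Q (a * (frob p l u * u)) (b * u ^+ 2) x.
  by rewrite !qformE frobM; congr (Tr _); ring.
have -> : Tr (c * (u * x + v)) = Tr (c * u * x) + Tr (c * v).
  by rewrite mulrDr mulrA (TrD p_pr cardF).
have -> : Tr ((L a b v * u + c * u) * x) = Tr (L a b v * (u * x)) + Tr (c * u * x).
  by rewrite mulrDl -mulrA (TrD p_pr cardF).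
by rewrite /=; ring.
Qed.

Lemma wt_codeword a b c h : (wt (cw a b c h) + zeros p m l a b c h)%N = q.
Proof.
rewrite /wt /zeros -cardF -(cardsC (supp (cw a b c h))); congr (_ + _)%N.
by apply/eq_card=> x; rewrite !inE negbK.
Qed.

Lemma ratqE : q%:R = P ^+ 2 * t ^+ 2.
Proof.
by rewrite natrX mE -exprM -exprD -mulSn mulnC.
Qed.

Lemma t_geP : P <= t.
Proof.
rewrite -natrX ler_nat; apply: (@leq_trans (p ^ 1)%N); first by rewrite expn1.
by rewrite leq_exp2l ?prime_gt1.
Qed.

Lemma odd_m : odd m = false.
Proof. by rewrite mE oddM. Qed.

Lemma half_pow j : (p ^ (m + 2 * j)./2)%:R = P ^+ j.+1 * t.
Proof.
by rewrite natrX -exprD mE -mulnDr mul2n doubleK addSn [(r + j)%N]addnC.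
Qed.

Lemma half_pow_odd : (p ^ (m + 1)./2)%:R = P * t.
Proof.
rewrite natrX -exprS mE addnC mul2n; congr (_ ^+ _).
exact: (half_bit_double _ true).
Qed.

(** The possible pairs ([#|K|], [gsum]) off the zero form. As [m] is even, [#|K| = p ^ j] with [j]
    even leaves both signs of [p ^ ((m + j) / 2)], and [j = 1] gives [0]. *)
Definition form_types : seq (nat * rat) :=
  [:: (1%N, P * t); (1%N, - (P * t)); (p, 0);
      ((p ^ 2)%N, P ^+ 2 * t); ((p ^ 2)%N, - (P ^+ 2 * t))].

Lemma form_typeP a b : (a != 0) || (b != 0) ->
  (#|K a b|, g a b) \in form_types.
Proof.
move=> ab0; have [K1|Kp|Kp2] := card_radical p_pr p_odd cardF co_ml ab0.
- have := @level_dichotomy F p m l p_pr p_odd cardF a b 0 K1.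
  have := half_pow 0%N; rewrite muln0 expr1 => ->.
  by rewrite addn0 odd_m K1 => -[[]-> _]; rewrite !inE eqxx ?orbT.
- have := @level_dichotomy F p m l p_pr p_odd cardF a b 1 Kp.
  by rewrite /= oddD odd_m /= Kp => -[-> _]; rewrite !inE eqxx ?orbT.
have := @level_dichotomy F p m l p_pr p_odd cardF a b 2 Kp2.
have := half_pow 1%N; rewrite muln1 => ->.
by rewrite oddD odd_m /= Kp2 => -[[]-> _]; rewrite !inE eqxx ?orbT.
Qed.

Lemma zeros_mean_or_level a b c h :
  (p * zeros p m l a b c h)%N = q \/ exists v, zeros p m l a b c h = N a b v.
Proof.
have [/(polar_imageP l p_pr p_odd cardF)[y ->]|] := boolP [forall x in K a b, Tr (c * x) == 0].
  by right; exists (Q a b y - h); rewrite zeros_polar.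
by move/(polar_imageP l p_pr p_odd cardF) => /(zeros_not_polar p_pr p_odd cardF h); left.
Qed.

Lemma P_neq0 : P != 0.
Proof. by have := ratp_gt2 p_pr p_odd => ?; lra. Qed.

Definition num_zeros (a b : F) (z : nat) : nat :=
  #|[set u : F * 'F_p | zeros p m l a b u.1 u.2 == z]|.

(** Each of the [q / #|K|] coefficients [c] in the image of the polar map meets the level of every
    [v] once as [h] varies; any other [c] gives [q / p] zeros for all [p] values of [h]. *)
Lemma num_zerosE a b z : (num_zeros a b z)%:R =
  q%:R / #|K a b|%:R * (\sum_v (N a b v == z)%:R) +
  P * (q%:R - q%:R / #|K a b|%:R) * (z%:R == q%:R / P)%:R :> rat.
Proof.
have P0 := P_neq0.
have K0 : #|K a b|%:R != 0 :> rat by rewrite pnatr_eq0 -lt0n radical_gt0.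
have zE : (z%:R == q%:R / P) = (p * z == q)%N.
  by rewrite -(inj_eq (mulfI P0)) mulrCA divff // mulr1 -natrM eqr_nat.
pose I := L a b @: setT.
have IE : q%:R / #|K a b|%:R = #|I|%:R :> rat.
  by rewrite {1}(card_polar_image l p_pr cardF a b) natrM mulrC mulKf.
have -> : (num_zeros a b z)%:R =
    \sum_c \sum_h (zeros p m l a b c h == z)%:R :> rat.
  rewrite /num_zeros -sum1dep_card natr_sum big_mkcond /=.
  rewrite (pair_bigA _ (fun c h => (zeros p m l a b c h == z)%:R)) /=.
  by apply: eq_bigr => u _; case: (_ == _).
rewrite (bigID [in I]) /= IE; congr (_ + _).
  rewrite (eq_bigr (fun=> \sum_v (N a b v == z)%:R)) => [|_ /imsetP[y _ ->]].
    by rewrite sumr_const -[LHS]mulr_natl cardE.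
  rewrite [RHS](reindex_inj (h := fun h => Q a b y - h)) /=; last first.
    by move=> h h' /addrI/oppr_inj.
  by apply: eq_bigr => h _; rewrite (zeros_polar l p_pr cardF).
rewrite (eq_bigr (fun=> P * (z%:R == q%:R / P)%:R)) => [|c cI].
  rewrite sumr_const -[LHS]mulr_natl.
  have -> : #|(fun c : F => c \notin I)|%:R = q%:R - #|I|%:R :> rat.
    by rewrite -cardF -(cardC [in I]) natrD [X in _ = X - _]addrC addrK.
  by ring.
rewrite (eq_bigr (fun=> (z%:R == q%:R / P)%:R)) => [|h _].
  by rewrite sumr_const card_Fp // -[LHS]mulr_natl.
have nc : ~ (exists y, c = L a b y).
  by case=> y cy; case/negP: cI; rewrite cy; apply: imset_f.
rewrite zE -(zeros_not_polar p_pr p_odd cardF h nc) eqn_pmul2l ?prime_gt0 //.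
by rewrite eq_sym.
Qed.

(** [num_zerosE] with the levels of [level_dichotomy] inserted. In the branch [R == p] the nonzero
    levels are split evenly between two values. *)
Definition type_weight (z : rat) (R : nat) (x : rat) : rat :=
  if R == p then
    q%:R / P * ((z == q%:R / P)%:R
      + (P - 1) / 2%:R * ((z == q%:R / P + P * t)%:R + (z == q%:R / P - P * t)%:R))
    + P * (q%:R - q%:R / P) * (z == q%:R / P)%:R
  else
    q%:R / R%:R * ((z == (q%:R + (P - 1) * x) / P)%:R
      + (P - 1) * (z == (q%:R - x) / P)%:R)
    + P * (q%:R - q%:R / R%:R) * (z == q%:R / P)%:R.

Lemma num_zeros_even a b j z : #|K a b| = (p ^ j)%N -> odd j = false ->
  (num_zeros a b z)%:R = type_weight z%:R #|K a b| (g a b).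
Proof.
move=> Kj odd_j; rewrite num_zerosE /type_weight ifF; last first.
  apply/negbTE/eqP => Kp; move: Kj; rewrite Kp -[LHS]expn1 => /eqP.
  by rewrite eqn_exp2l ?prime_gt1 // => /eqP jE; rewrite -jE in odd_j.
congr (_ * _ + _); have := @level_dichotomy F p m l p_pr p_odd cardF a b j Kj.
rewrite /= oddD odd_m odd_j /= => -[_ Nv].
rewrite (bigD1 0) //= -[in LHS](eqr_nat rat) (level0E m l p_pr p_odd) eq_sym.
congr (_ + _); rewrite (eq_bigr (fun=> (z%:R == (q%:R - g a b) / P)%:R)).
  rewrite sumr_const cardC1 card_Fp // -[LHS]mulr_natl -subn1 natrB //.
  exact: prime_gt0.
by move=> v v0; rewrite -(Nv v v0) eqr_nat eq_sym.
Qed.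

Lemma num_zeros_type a b z :
  (num_zeros a b z)%:R = type_weight z%:R #|K a b| (g a b).
Proof.
have [ab0|] := boolP ((a != 0) || (b != 0)); last first.
  rewrite negb_or !negbK => /andP[/eqP-> /eqP->].
  (* The zero form is covered with [j = m], which is even: its radical is the whole field. *)
  by apply: (num_zeros_even (j := m)); rewrite ?radical00 ?odd_m.
have [K1|Kp|Kp2] := card_radical p_pr p_odd cardF co_ml ab0.
- exact: (num_zeros_even (j := 0)).
- rewrite num_zerosE /type_weight Kp eqxx; congr (_ * _ + _).
  have := @level_dichotomy F p m l p_pr p_odd cardF a b 1 Kp.
  rewrite half_pow_odd.
  rewrite oddD odd_m /= => -[g0 [u [w [Nu Nw _ NG]]]].
  rewrite (NG _ (fun n => (n == z)%:R)) -Nu -Nw !eqr_nat.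
  have := level0E m l p_pr p_odd a b; rewrite g0 mulr0 addr0 => <-.
  rewrite !eqr_nat !(eq_sym z); congr (_ + _); rewrite -[LHS]mulr_natl.
  congr (_ * _); have -> : P = 2%:R * (p./2)%:R + 1.
    by rewrite -natrM -[1]/(1%:R) -natrD -{1}(odd_double_half p) p_odd addnC mul2n.
  by field.
exact: (num_zeros_even (j := 2)).
Qed.

(** The bound is the level of [0] for a form with [#|K| = p ^ 2] and [gsum = P ^ 2 * t]. *)
Lemma level_le a b v : (a != 0) || (b != 0) ->
  (N a b v)%:R <= P * t ^+ 2 + (P ^+ 2 - P) * t.
Proof.
move=> ab0; have p2 := ratp_gt2 p_pr p_odd; have tP := t_geP; have P0 := P_neq0.
have qP : q%:R / P = P * t ^+ 2 by rewrite ratqE; field.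
have Pt0 : 0 <= P * t by apply: mulr_ge0; lra.
have PPt : 2%:R * (P * t) <= P ^+ 2 * t by rewrite expr2 -mulrA ler_wpM2r //; lra.
have even_case j : #|K a b| = (p ^ j)%N -> odd j = false ->
    `|g a b| <= P ^+ 2 * t ->
    (N a b v)%:R <= P * t ^+ 2 + (P ^+ 2 - P) * t.
  move=> Kj odd_j; rewrite -(divfK P0 (g a b)) normrM [`|P|]ger0_norm; last by lra.
  rewrite expr2 -mulrA mulrC ler_pM2l; last by lra.
  set x := g a b / P; rewrite ler_norml => /andP[x1 x2].
  have := @level_dichotomy F p m l p_pr p_odd cardF a b j Kj.
  rewrite /= oddD odd_m odd_j /= => -[_ Nv].
  have [->|v0] := eqVneq v 0; last first.
    by rewrite Nv // mulrDl mulNr qP -/x; move: PPt; lra.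
  rewrite (level0E m l p_pr p_odd) mulrDl qP lerD2l -mulrA -/x.
  apply: (@le_trans _ _ ((P - 1) * (P * t))); last by lra.
  by rewrite ler_wpM2l //; lra.
have := form_typeP ab0; rewrite !inE => typ.
have g_le : `|g a b| <= P ^+ 2 * t.
  by case/or4P: typ => [/eqP[_ ->]|/eqP[_ ->]|/eqP[_ ->]|/orP[]/eqP[_ ->]];
    rewrite ?normrN ?normr0 ?ger0_norm //; lra.
have [K1|Kp|Kp2] := card_radical p_pr p_odd cardF co_ml ab0.
- exact: (even_case 0%N).
- have := @level_dichotomy F p m l p_pr p_odd cardF a b 1 Kp.
  rewrite half_pow_odd.
  rewrite oddD odd_m /= => -[g0 [u [w [Nu Nw Nv _]]]].
  have [->|/Nv[]->] := eqVneq v 0; rewrite ?Nu ?Nw ?qP; last 2 first.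
  + by move: PPt; lra.
  + by move: PPt Pt0; lra.
  rewrite (level0E m l p_pr p_odd) g0 mulr0 addr0 qP; move: PPt Pt0; lra.
exact: (even_case 2).
Qed.

(** For [a = b = 0], a nonzero linear term leaves [q / p] zeros and a nonzero constant none. The
    bound yields both the minimum distance and the injectivity of the parametrisation. *)
Lemma zeros_le (a b c : F) (h : 'F_p) : [|| a != 0, b != 0, c != 0 | h != 0] ->
  (zeros p m l a b c h)%:R <= P * t ^+ 2 + (P ^+ 2 - P) * t.
Proof.
move=> u0; have p2 := ratp_gt2 p_pr p_odd; have tP := t_geP; have P0 := P_neq0.
have Pt0 : 0 <= P * t by apply: mulr_ge0; lra.
have PPt : 2%:R * (P * t) <= P ^+ 2 * t by rewrite expr2 -mulrA ler_wpM2r //; lra.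
have tt0 : 0 <= P * t ^+ 2 by apply: mulr_ge0; rewrite ?sqr_ge0 //; lra.
have mean : (p * zeros p m l a b c h)%N = q ->
    (zeros p m l a b c h)%:R <= P * t ^+ 2 + (P ^+ 2 - P) * t.
  move=> zq; have -> : (zeros p m l a b c h)%:R = P * t ^+ 2.
    by apply: (mulfI P0); rewrite -natrM zq ratqE; ring.
  by move: PPt Pt0; lra.
have [ab0|] := boolP ((a != 0) || (b != 0)).
  by have [/mean|[v ->]] := zeros_mean_or_level a b c h; rewrite ?level_le.
rewrite negb_or !negbK => /andP[/eqP a0 /eqP b0].
have [c0|c0] := eqVneq c 0; last first.
  apply/mean/(zeros_not_polar p_pr p_odd cardF) => -[y cy]; case/eqP: c0.
  by rewrite cy a0 b0 /polar !(mul0r, mulr0) (frob0 F p_pr) !addr0.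
have h0 : h != 0 by move: u0; rewrite a0 b0 c0 !eqxx.
rewrite (_ : zeros _ _ _ _ _ _ _ = 0%N); first by move: PPt Pt0 tt0; lra.
apply/eqP; rewrite cards_eq0 -subset0; apply/subsetP=> x; rewrite inE.
rewrite (codewordE l p_pr cardF) a0 b0 c0 qform00 // mul0r (Tr0 p_pr cardF).
by rewrite !add0r (negPf h0).
Qed.

Lemma codeword_inj : injective (fun u : F * F * F * 'F_p => cw u.1.1.1 u.1.1.2 u.1.2 u.2).
Proof.
move=> [[[a b] c] h] [[[a' b'] c'] h'] /= uu'.
have [|] := boolP [|| a - a' != 0, b - b' != 0, c - c' != 0 | h - h' != 0]; last first.
  by rewrite !negb_or !negbK !subr_eq0 => /and4P[/eqP-> /eqP-> /eqP-> /eqP->].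
move/zeros_le; have p2 := ratp_gt2 p_pr p_odd; have tP := t_geP.
rewrite (_ : zeros _ _ _ _ _ _ _ = q); last first.
  rewrite /zeros -cardF -cardsT; apply/eq_card=> x; rewrite !inE.
  have /ffunP/(_ x)/eqP := uu'; rewrite -subr_eq0 => /eqP <-; apply/eqP.
  rewrite !ffunE opprD addrACA -(TrN p_pr cardF) -(TrD p_pr cardF).
  by congr (Tr _ + _); ring.
(* This product is [q] minus the bound of [zeros_le], whereas the difference of two equal words has
   [q] zeros. *)
rewrite ratqE; have d0 : 0 < P * (P - 1) * (t * (t - 1)).
  by rewrite !mulr_gt0 //; lra.
by clear uu' => le_q; exfalso; lra.
Qed.

Lemma num_wt_D1 k z : (k + z)%N = q ->
  num_wt C k = (\sum_(ab : F * F) num_zeros ab.1 ab.2 z)%N.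
Proof.
move=> kz; rewrite /num_wt.
transitivity #|[set u : F * F * F * 'F_p | zeros p m l u.1.1.1 u.1.1.2 u.1.2 u.2 == z]|.
  rewrite -[RHS](card_imset _ codeword_inj); apply/eq_card=> w.
  have wtE u : (wt (cw u.1.1.1 u.1.1.2 u.1.2 u.2) == k) =
               (zeros p m l u.1.1.1 u.1.1.2 u.1.2 u.2 == z).
    have := wt_codeword u.1.1.1 u.1.1.2 u.1.2 u.2; rewrite -kz => E.
    by apply/eqP/eqP => W; move: E; rewrite W; [move/addnI | move/addIn].
  rewrite inE; apply/andP/imsetP => [[/imsetP[u _ ->]]|[u uz ->]].
    by rewrite wtE; exists u; rewrite ?inE.
  by rewrite wtE mem_D1; split=> //; rewrite inE in uz.
rewrite -sum1dep_card big_mkcond /=.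
rewrite (reindex (fun v : (F * F) * (F * 'F_p) => (v.1, v.2.1, v.2.2))) /=; last first.
  by exists (fun u => (u.1.1, (u.1.2, u.2))) => [[[? ?] [? ?]]|[[[? ?] ?] ?]].
rewrite -(pair_bigA _ (fun ab ch => if zeros p m l ab.1 ab.2 ch.1 ch.2 == z then 1 else 0)%N) /=.
by apply: eq_bigr => ab _; rewrite /num_zeros -sum1dep_card [RHS]big_mkcond.
Qed.

End CodeWeights.

(** * Arithmetic of the weight distribution *)

Lemma weight_factors_gt0 (P t : rat) : 2%:R < P -> P <= t ->
  let q := P ^+ 2 * t ^+ 2 in
  [/\ [/\ 0 < P, 0 < t, 0 < P - 1, 0 < t - 1 & 0 < t + 1],
      [/\ 0 < P * t - 1, 0 < P * t + 1, 0 < P ^+ 2 - 1, 0 < q & 0 < q - 1],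
      0 < (P ^+ 2 - P - 1) * t ^+ 2 - (P - 1) * t + 1,
      0 < (P ^+ 2 - P - 1) * t ^+ 2 + (P - 1) * t + 1 &
      0 < q - P * t ^+ 2 /\ 0 < q - t ^+ 2].
Proof.
move=> P_gt2 t_ge q.
have P1 : 0 < P - 1 by lra.
have t1 : 0 < t - 1 by lra.
have t0 : 0 < t by lra.
have P0 : 0 < P by lra.
have PtP : 0 < P * (t - 1) by apply: mulr_gt0.
have Pt1 : 0 < P * t - 1 by lra.
have D1 : 0 < (P - 1) * (P + 1) by apply: mulr_gt0 => //; lra.
have D2 : 0 < (P - 1) * (P - 2%:R) by apply: mulr_gt0 => //; lra.
have q1 : 0 < (P * t - 1) * (P * t + 1) by apply: mulr_gt0 => //; lra.
have a0 : 0 < P ^+ 2 - P - 1 by lra.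
have a1 : 0 < (P ^+ 2 - P - 1) * (t * (t - 1)) by rewrite !mulr_gt0.
have a2 : 0 < P * (P - 2%:R) * t by rewrite !mulr_gt0 //; lra.
have a3 : 0 < (P - 1) * t by rewrite mulr_gt0.
have t2 : 0 < t ^+ 2 by rewrite exprn_gt0.
have a4 : 0 < P * (P - 1) * t ^+ 2 by rewrite !mulr_gt0.
have a5 : 0 < (P - 1) * (P + 1) * t ^+ 2 by rewrite mulr_gt0.
by rewrite /q; split; [split | split | | | split]; lra.
Qed.

Section TypeArithmetic.

Variables (P t n1 n2 n3 n4 n5 : rat).

Local Notation q := (P ^+ 2 * t ^+ 2).

(** The system is triangular in sums and differences: the third equation, whose weight kills
    [#|K| = 1] and [#|K| = p], gives [n4 + n5], and the last two give [n4 - n5]. The leading terms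
    on the left are the contribution of the zero form. *)
Lemma type_counts : 2%:R < P -> P <= t ->
    n1 + n2 + n3 + n4 + n5 = q ^+ 2 - 1 ->
    q + (n1 + n2 + P * n3 + P ^+ 2 * (n4 + n5)) = q ^+ 2 + (q - 1) * q ->
    (q - 1) * (q - P) + (P ^+ 2 - 1) * (P ^+ 2 - P) * (n4 + n5) =
      (q - 1) * ((q - P) * P) ->
    q + (P * t * (n1 - n2) + P ^+ 2 * t * (n4 - n5)) = q ^+ 2 ->
    q * q + (P * t * (n1 - n2) + P ^+ 2 * t * P ^+ 2 * (n4 - n5)) =
      q ^+ 2 + (q - 1) * (q * P) ->
  [/\ n1 = P ^+ 2 * (q - 1) * ((P ^+ 2 - P - 1) * t ^+ 2 + (P - 1) * t + 1)
           / (2%:R * (P ^+ 2 - 1)),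
      n2 = P ^+ 2 * (q - 1) * ((P ^+ 2 - P - 1) * t ^+ 2 - (P - 1) * t + 1)
           / (2%:R * (P ^+ 2 - 1)),
      n3 = (q - 1) * P * t ^+ 2,
      n4 = (q - 1) * (P * t - 1) * (t + 1) / (2%:R * (P ^+ 2 - 1)) &
      n5 = (q - 1) * (P * t + 1) * (t - 1) / (2%:R * (P ^+ 2 - 1))].
Proof.
move=> P_gt2 t_ge mom_1 mom_R mom_RR mom_g mom_gR.
have Psq1 : 0 < (P - 1) * (P + 1) by apply: mulr_gt0; lra.
have P0 : P != 0 by lra.
have P10 : P + 1 != 0 by lra.
have P1 : P - 1 != 0 by lra.
have D0 : P ^+ 2 - 1 != 0 by lra.
have t0 : t != 0 by lra.
have s45 : n4 + n5 = (q - 1) * (q - P) / ((P ^+ 2 - 1) * P).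
  apply: (mulfI (mulf_neq0 D0 (mulf_neq0 P0 P1))).
  have -> : (P ^+ 2 - 1) * (P * (P - 1)) * ((q - 1) * (q - P) / ((P ^+ 2 - 1) * P))
          = (q - 1) * (q - P) * (P - 1) by field; rewrite P0 D0.
  by lra.
have d45 : n4 - n5 = (q - 1) * t / (P + 1).
  apply: (mulfI (mulf_neq0 D0 (mulf_neq0 (mulf_neq0 P0 P0) t0))).
  have -> : (P ^+ 2 - 1) * (P * P * t) * ((q - 1) * t / (P + 1))
          = (q - 1) * t * (P - 1) * (P * P * t) by field.
  by lra.
have n3E : n3 = (q - 1) * P * t ^+ 2.
  apply: (mulfI (mulf_neq0 P1 P0)).
  have s45' : (P ^+ 2 - 1) * P * (n4 + n5) = (q - 1) * (q - P).
    by rewrite s45; field; rewrite P0 D0.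
  have s3 : (P - 1) * n3 + (P ^+ 2 - 1) * (n4 + n5) = (q - 1) ^+ 2 by lra.
  have := congr1 (fun x => x * P) s3; lra.
have d12 : n1 - n2 = P ^+ 2 * t * (q - 1) / (P + 1).
  apply: (mulfI (mulf_neq0 P0 t0)).
  have -> : P * t * (P ^+ 2 * t * (q - 1) / (P + 1)) =
    q * (q - 1) - P ^+ 2 * t * ((q - 1) * t / (P + 1)) by field.
  by rewrite -d45; lra.
have n4E : n4 = (q - 1) * (P * t - 1) * (t + 1) / (2%:R * (P ^+ 2 - 1)).
  have -> : n4 = (n4 + n5 + (n4 - n5)) / 2%:R by field.
  by rewrite s45 d45; field; rewrite P0 P10 D0.
have n5E : n5 = (q - 1) * (P * t + 1) * (t - 1) / (2%:R * (P ^+ 2 - 1)).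
  have -> : n5 = (n4 + n5 - (n4 - n5)) / 2%:R by field.
  by rewrite s45 d45; field; rewrite P0 P10 D0.
have s12 : n1 + n2 = q ^+ 2 - 1 - n3 - (n4 + n5) by lra.
split=> //.
  have -> : n1 = (n1 + n2 + (n1 - n2)) / 2%:R by field.
  by rewrite s12 d12 n3E s45; field; rewrite P0 P10 D0.
have -> : n2 = (n1 + n2 - (n1 - n2)) / 2%:R by field.
by rewrite s12 d12 n3E s45; field; rewrite P0 P10 D0.
Qed.

(** This is [type_weight] in the scaled variables [z = P * t ^ 2 + t * c] and [gsum = P * t * y]:
    [c] is the deviation from the mean number of zeros in units of [t]. *)
Definition even_weight (R y c : rat) : rat :=
  q / R * ((c == (P - 1) * y)%:R + (P - 1) * (c == - y)%:R)
  + P * (q - q / R) * (c == 0)%:R.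

Definition odd_weight (c : rat) : rat :=
  q / P * ((c == 0)%:R + (P - 1) / 2%:R * ((c == P)%:R + (c == - P)%:R))
  + P * (q - q / P) * (c == 0)%:R.

(** The first summand is the zero form, where [gsum = q] means [y = P * t]; the others follow the
    order of [form_types]. *)
Definition num_weight (c : rat) : rat :=
  even_weight q (P * t) c + n1 * even_weight 1 1 c + n2 * even_weight 1 (-1) c
  + n3 * odd_weight c + n4 * even_weight (P ^+ 2) P c
  + n5 * even_weight (P ^+ 2) (- P) c.

Ltac decide_tests :=
  rewrite /num_weight /even_weight /odd_weight;
  repeat match goal with |- context [nat_of_bool (?x == ?y)] =>
    first [ rewrite (_ : (x == y) = true); last by apply/eqP; ring
          | rewrite (_ : (x == y) = false); last by apply/negbTE/eqP => ?; lra ]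
  end; rewrite /=.

(** Types share a deviation only at [0] and at [P], [- P], where nonzero levels for [#|K| = p] meet
    nonzero levels for [#|K| = p ^ 2]. *)
Lemma num_weights : 2%:R < P -> P <= t ->
  [/\ num_weight 0 = P * (q - 1) + n3 * (q / P + P * (q - q / P))
                     + (n4 + n5) * (P * (q - q / P ^+ 2)),
      num_weight (- (P - 1)) = n2 * q,
      num_weight (P - 1) = n1 * q,
      num_weight (P * (P - 1)) = n4 * (q / P ^+ 2) &
      num_weight (- (P * (P - 1))) = n5 * (q / P ^+ 2)] /\
  [/\ num_weight (-1) = n1 * (q * (P - 1)),
      num_weight 1 = n2 * (q * (P - 1)),
      num_weight (- P) = n3 * (q / P * ((P - 1) / 2%:R)) + n4 * (q / P ^+ 2 * (P - 1)) &
      num_weight P = n3 * (q / P * ((P - 1) / 2%:R)) + n5 * (q / P ^+ 2 * (P - 1))].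
Proof.
move=> P_gt2 t_ge; have P0 : P != 0 by lra.
have t0 : t != 0 by lra.
have h1 : 0 < P * (P - 2%:R) by apply: mulr_gt0; lra.
have h2 : 0 <= P * (t - P) by apply: mulr_ge0; lra.
have h3 : 0 < P * (P - 2%:R) * t by apply: mulr_gt0; lra.
by split; split; decide_tests; field; rewrite ?P0 ?t0.
Qed.

(** There are [num_weight c / (P - 1)] blocks, so the equation is the usual relation between block
    number and [lam] with denominators cleared; positivity says that the weight occurs. *)
Definition design_number (c lam : rat) : Prop :=
  let k := q - (P * t ^+ 2 + t * c) in
  0 < num_weight c /\ num_weight c * (k * (k - 1)) = lam * (q * (q - 1) * (P - 1)).

Lemma design_numbers : 2%:R < P -> P <= t ->
    n1 = P ^+ 2 * (q - 1) * ((P ^+ 2 - P - 1) * t ^+ 2 + (P - 1) * t + 1)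
      / (2%:R * (P ^+ 2 - 1)) ->
    n2 = P ^+ 2 * (q - 1) * ((P ^+ 2 - P - 1) * t ^+ 2 - (P - 1) * t + 1)
      / (2%:R * (P ^+ 2 - 1)) ->
    n3 = (q - 1) * P * t ^+ 2 ->
    n4 = (q - 1) * (P * t - 1) * (t + 1) / (2%:R * (P ^+ 2 - 1)) ->
    n5 = (q - 1) * (P * t + 1) * (t - 1) / (2%:R * (P ^+ 2 - 1)) ->
  [/\ design_number 0 ((q - P * t ^+ 2 - 1)
         * (P ^+ 3 * t ^+ 4 - P ^+ 2 * t ^+ 4 + 2%:R * (P * t ^+ 4) - t ^+ 2 + 1)),
      design_number (- (P - 1)) (P ^+ 2 * t * (q - P * t ^+ 2 + t * (P - 1) - 1)
         * (P * t + 1) * (q - P * t ^+ 2 - t ^+ 2 - P * t + t + 1)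
         / (2%:R * (P ^+ 2 - 1))),
      design_number (P - 1) (P ^+ 2 * t * (q - P * t ^+ 2 - t * (P - 1) - 1)
         * (P * t - 1) * (q - P * t ^+ 2 - t ^+ 2 + P * t - t + 1)
         / (2%:R * (P ^+ 2 - 1))),
      design_number (P * (P - 1)) (t / P * (t ^+ 2 - 1) * (P * t - 1)
         * (q - P * t ^+ 2 - P ^+ 2 * t + P * t - 1) / (2%:R * (P ^+ 2 - 1))) &
      design_number (- (P * (P - 1))) (t / P * (t ^+ 2 - 1) * (P * t + 1)
         * (q - P * t ^+ 2 + P * t * (P - 1) - 1) / (2%:R * (P ^+ 2 - 1)))] /\
  [/\ design_number (-1) (P ^+ 2 * t * (q - P * t ^+ 2 + t - 1)
         * (P ^+ 2 * t - P * t + 1) * (q - P * t ^+ 2 - t ^+ 2 + P * t - t + 1)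
         / (2%:R * (P ^+ 2 - 1))),
      design_number 1 (P ^+ 2 * t * (q - P * t ^+ 2 - t - 1)
         * (P ^+ 2 * t - P * t - 1) * (q - P * t ^+ 2 - t ^+ 2 - P * t + t + 1)
         / (2%:R * (P ^+ 2 - 1))),
      design_number (- P) (t / P * (q - P * t ^+ 2 + P * t - 1)
         * (P * t - t + 1) * (P ^+ 2 * q - q + P * t ^+ 2 + P * t - t - 1)
         / (2%:R * (P ^+ 2 - 1))) &
      design_number P (t / P * (q - P * t ^+ 2 - P * t - 1)
         * (P * t - t - 1) * (P ^+ 2 * q - q + P * t ^+ 2 - P * t + t - 1)
         / (2%:R * (P ^+ 2 - 1)))].
Proof.
move=> P_gt2 t_ge; have [[w1 w2 w3 w4 w9] [w5 w7 w6 w8]] := num_weights P_gt2 t_ge.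
move=> n1E n2E n3E n4E n5E.
have [[P0 t0 P1 t1 t1'] [Pt1 Pt1' D q0 q1] f1 f2 [qP_gt0 qt_gt0]] :=
  weight_factors_gt0 P_gt2 t_ge.
have P_n0 : P != 0 by rewrite gt_eqF.
have D0 : P ^+ 2 - 1 != 0 by rewrite gt_eqF.
have n1_gt0 : 0 < n1 by rewrite n1E !(invr_gt0, mulr_gt0) ?exprn_gt0.
have n2_gt0 : 0 < n2 by rewrite n2E !(invr_gt0, mulr_gt0) ?exprn_gt0.
have n3_gt0 : 0 < n3 by rewrite n3E !mulr_gt0 ?exprn_gt0.
have n4_gt0 : 0 < n4 by rewrite n4E !(invr_gt0, mulr_gt0).
have n5_gt0 : 0 < n5 by rewrite n5E !(invr_gt0, mulr_gt0).
have t2 : 0 < t ^+ 2 by rewrite exprn_gt0.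
have Pt2 : 0 < P * t ^+ 2 by rewrite mulr_gt0.
have half_gt0 : 0 < 2%:R^-1 :> rat by [].
have qP2 : q / P ^+ 2 = t ^+ 2 by field.
have qP : q / P = P * t ^+ 2 by field.
split; split; rewrite /design_number ?w1 ?w2 ?w3 ?w4 ?w5 ?w6 ?w7 ?w8 ?w9 ?qP2 ?qP;
  (split; first by repeat first [assumption | apply: addr_gt0 | apply: mulr_gt0]);
  rewrite ?n1E ?n2E ?n3E ?n4E ?n5E; field; rewrite ?P_n0 ?D0 //.
Qed.

End TypeArithmetic.

(** * Number of codewords of each weight *)

Section WeightDistribution.

Variables (F : finFieldType) (p m l r : nat).
Hypotheses (p_pr : prime p) (p_odd : odd p) (cardF : #|F| = (p ^ m)%N).
Hypothesis co_ml : gcdn m l = 1%N.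
Hypotheses (mE : m = (2 * r.+1)%N) (r_gt0 : (0 < r)%N).

Local Notation q := (p ^ m)%N.
Local Notation P := (p%:R : rat).
Local Notation t := (P ^+ r).
Local Notation K := (@radical F p m l).
Local Notation g := (@gsum F p m l).
Local Notation C := (D1 F p m l).

Definition num_type (x : nat * rat) : rat :=
  \sum_(ab : F * F | (ab.1 != 0) || (ab.2 != 0))
    ((#|K ab.1 ab.2|, g ab.1 ab.2) == x)%:R.

Lemma form_types_uniq : uniq (form_types p r).
Proof.
have p2 := ratp_gt2 p_pr p_odd; have tP := t_geP p_pr r_gt0.
have Pt : 0 < P * t by apply: mulr_gt0; lra.
have PPt : 0 < P ^+ 2 * t by apply: mulr_gt0; rewrite ?exprn_gt0 //; lra.
have p1 := prime_gt1 p_pr.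
have np2 : (p == p ^ 2)%N = false.
  by rewrite -{1}[p]expn1 eqn_exp2l.
have n1p2 : (1 == p ^ 2)%N = false by rewrite -(expn0 p) eqn_exp2l.
have n1p : (1 == p)%N = false by rewrite ltn_eqF.
have d1 : (P * t == - (P * t)) = false by apply/eqP => ?; lra.
have d2 : (P ^+ 2 * t == - (P ^+ 2 * t)) = false by apply/eqP => ?; lra.
by rewrite /= !inE !xpair_eqE np2 n1p2 n1p d1 d2 !andbF.
Qed.

(** A generic [G] lets one regrouping yield the moment equations and the weight counts. *)
Lemma sum_over_types (G : nat -> rat -> rat) :
  \sum_(ab : F * F) G #|K ab.1 ab.2| (g ab.1 ab.2) =
  G q q%:R + \sum_(x <- form_types p r) num_type x * G x.1 x.2.
Proof.
rewrite (bigD1 (0, 0)) //= radical00 // gsum00 //; congr (_ + _).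
under [RHS]eq_bigr => x _ do rewrite mulr_suml.
rewrite exchange_big /=; apply: eq_big => [[a b]|[a b]] /=.
  by rewrite xpair_eqE negb_and.
rewrite xpair_eqE negb_and => ab0.
have typ := form_typeP p_pr p_odd cardF co_ml mE ab0.
rewrite (bigD1_seq _ typ form_types_uniq) /= eqxx mul1r big1 ?addr0 // => x.
by rewrite eq_sym => /negPf->; rewrite mul0r.
Qed.

Local Notation n1 := (num_type (1%N, P * t)).
Local Notation n2 := (num_type (1%N, - (P * t))).
Local Notation n3 := (num_type (p, 0)).
Local Notation n4 := (num_type ((p ^ 2)%N, P ^+ 2 * t)).
Local Notation n5 := (num_type ((p ^ 2)%N, - (P ^+ 2 * t))).

Lemma sum_over_typesE (G : nat -> rat -> rat) :
  \sum_(ab : F * F) G #|K ab.1 ab.2| (g ab.1 ab.2) =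
  G q q%:R + (n1 * G 1%N (P * t) + n2 * G 1%N (- (P * t)) + n3 * G p 0
    + n4 * G (p ^ 2)%N (P ^+ 2 * t) + n5 * G (p ^ 2)%N (- (P ^+ 2 * t))).
Proof.
by rewrite sum_over_types /form_types !big_cons big_nil /= addr0 !addrA.
Qed.

Lemma num_typesE : let Q := P ^+ 2 * t ^+ 2 in
  [/\ n1 = P ^+ 2 * (Q - 1) * ((P ^+ 2 - P - 1) * t ^+ 2 + (P - 1) * t + 1)
           / (2%:R * (P ^+ 2 - 1)),
      n2 = P ^+ 2 * (Q - 1) * ((P ^+ 2 - P - 1) * t ^+ 2 - (P - 1) * t + 1)
           / (2%:R * (P ^+ 2 - 1)),
      n3 = (Q - 1) * P * t ^+ 2,
      n4 = (Q - 1) * (P * t - 1) * (t + 1) / (2%:R * (P ^+ 2 - 1)) &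
      n5 = (Q - 1) * (P * t + 1) * (t - 1) / (2%:R * (P ^+ 2 - 1))].
Proof.
have qE := ratqE p mE; have q_gt0 : (0 < q)%N by rewrite expn_gt0 prime_gt0.
have p_gt0 := prime_gt0 p_pr.
have pq : (p <= q)%N by rewrite -{1}[p]expn1 leq_exp2l ?prime_gt1 // mE.
have pp2 : (p <= p ^ 2)%N by rewrite -{1}[p]expn1 leq_exp2l ?prime_gt1.
have p2E : (p ^ 2)%:R = P ^+ 2 by rewrite natrX.
apply: type_counts; first exact: ratp_gt2; first exact: t_geP.
- have := sum_over_typesE (fun _ _ => 1); rewrite !mulr1 sumr_const card_prod cardF.
  by rewrite natrM qE -[P ^+ 2 * t ^+ 2 * (P ^+ 2 * t ^+ 2)]expr2 => ->; ring.
- have := sum_over_typesE (fun R _ => R%:R).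
  rewrite -natr_sum (sum_card_radical l p_pr p_odd cardF) natrD natrM -subn1.
  rewrite natrB // -mulnn natrM qE p2E -[P ^+ 2 * t ^+ 2 * (P ^+ 2 * t ^+ 2)]expr2 => ->.
  by ring.
- have := sum_over_typesE (fun R _ => (R.-1 * (R - p))%:R).
  rewrite -natr_sum (sum_card_radical_pairs p_pr p_odd cardF co_ml) /=.
  rewrite mul0n subnn muln0 !mulr0 !add0r -!subn1 !natrM.
  rewrite !natrB ?expn_gt0 ?p_gt0 // qE p2E => ->.
  by ring.
- have := sum_over_typesE (fun _ x => x).
  by rewrite (sum_gsum l p_pr p_odd cardF) qE => ->; ring.
have := sum_over_typesE (fun R x => x * R%:R).
rewrite (sum_gsum_card_radical p_pr p_odd cardF co_ml) qE p2E => ->.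
by ring.
Qed.

Lemma type_weight_even R x y c z : R != p -> x = P * t * y ->
    z = P * t ^+ 2 + t * c ->
  type_weight p m r z R x = even_weight P t R%:R y c.
Proof.
move=> /negPf Rp -> ->; rewrite /type_weight Rp /even_weight (ratqE p mE).
have p2 := ratp_gt2 p_pr p_odd; have tP := t_geP p_pr r_gt0.
have P0 : P != 0 by lra.
have t0 : t != 0 by lra.
have eqE u v : u = P * t ^+ 2 + t * v -> (P * t ^+ 2 + t * c == u) = (c == v).
  by move=> ->; rewrite (inj_eq (addrI _)) (inj_eq (mulfI t0)).
rewrite (eqE _ ((P - 1) * y)); last by field.
rewrite (eqE _ (- y)); last by field.
by rewrite (eqE _ 0) //; field.
Qed.

Lemma type_weight_odd x c z : z = P * t ^+ 2 + t * c ->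
  type_weight p m r z p x = odd_weight P t c.
Proof.
move=> ->; rewrite /type_weight eqxx /odd_weight (ratqE p mE).
have p2 := ratp_gt2 p_pr p_odd; have tP := t_geP p_pr r_gt0.
have P0 : P != 0 by lra.
have t0 : t != 0 by lra.
have eqE u v : u = P * t ^+ 2 + t * v -> (P * t ^+ 2 + t * c == u) = (c == v).
  by move=> ->; rewrite (inj_eq (addrI _)) (inj_eq (mulfI t0)).
rewrite (eqE _ 0); last by field.
rewrite (eqE _ P); last by field.
by rewrite (eqE _ (- P)) //; field.
Qed.

Lemma num_wtE k z c : (k + z)%N = q -> z%:R = P * t ^+ 2 + t * c ->
  (num_wt C k)%:R = num_weight P t n1 n2 n3 n4 n5 c.
Proof.
move=> kz zE; rewrite (num_wt_D1 p_pr p_odd cardF co_ml mE r_gt0 kz) natr_sum.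
rewrite (eq_bigr (fun ab => type_weight p m r z%:R #|K ab.1 ab.2| (g ab.1 ab.2))).
  rewrite (sum_over_typesE (type_weight p m r z%:R)) /num_weight.
  have p1 := prime_gt1 p_pr.
  have R1 : 1%N != p by rewrite ltn_eqF.
  have R2 : (p ^ 2)%N != p by rewrite -[X in _ != X]expn1 eqn_exp2l.
  have Rq : q != p by rewrite -[X in _ != X]expn1 eqn_exp2l // mE; lia.
  rewrite (@type_weight_even q _ (P * t) c) //; last by rewrite (ratqE p mE); ring.
  rewrite (@type_weight_even 1%N _ 1 c) ?mulr1 //.
  rewrite (@type_weight_even 1%N _ (-1) c) ?mulrN1 //.
  rewrite (@type_weight_even (p ^ 2)%N _ P c) //; last by ring.
  rewrite (@type_weight_even (p ^ 2)%N _ (- P) c) //; last by ring.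
  by rewrite (type_weight_odd _ zE) [(p ^ 2)%:R]natrX (ratqE p mE) !addrA.
by move=> ab _; rewrite (num_zeros_type p_pr p_odd cardF co_ml mE).
Qed.

End WeightDistribution.

(** * From weight counts to the stated designs *)

Section DesignsFromWeights.

Variables (F : finFieldType) (p m l r : nat).
Hypotheses (p_pr : prime p) (p_odd : odd p) (cardF : #|F| = (p ^ m)%N).
Hypothesis co_ml : gcdn m l = 1%N.
Hypotheses (mE : m = (2 * r.+1)%N) (r_gt0 : (0 < r)%N).

Local Notation q := (p ^ m)%N.
Local Notation P := (p%:R : rat).
Local Notation t := (P ^+ r).
Local Notation C := (D1 F p m l).
Local Notation num := (num_type F p m l).
Local Notation numw := (num_weight P t (num (1%N, P * t)) (num (1%N, - (P * t)))
  (num (p, 0)) (num ((p ^ 2)%N, P ^+ 2 * t)) (num ((p ^ 2)%N, - (P ^+ 2 * t)))).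

Lemma supports_affine k (u v : F) (b : {set F}) : u != 0 -> b \in supports C k ->
  [set x | u * x + v \in b] \in supports C k.
Proof.
move=> u0 /imsetP[w + ->]; rewrite inE => /andP[Cw /eqP wtw].
pose w' := [ffun x => w (u * x + v)].
have sE : [set x | u * x + v \in supp w] = supp w'.
  by apply/setP=> x; rewrite !inE ffunE.
rewrite sE; apply/imsetP; exists w' => //; rewrite inE; apply/andP; split.
  exact: D1_affine.
have inj : injective (fun x => u * x + v) by move=> x y /addIr/(mulfI u0).
rewrite -wtw /wt -sE -[X in X == _](card_imset _ inj); apply/eqP/eq_card=> y.
apply/imsetP/idP => [[x + ->]|wy]; first by rewrite in_set.
have uy : u * ((y - v) / u) + v = y by rewrite mulrC divfK // subrK.
by exists ((y - v) / u); rewrite // in_set uy.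
Qed.

Lemma min_wt_D1 w : w \in C -> w != [ffun=> 0] ->
  (q - (p * p ^ (2 * r) + (p ^ 2 - p) * p ^ r) <= wt w)%N.
Proof.
case/imsetP=> -[[[a b] c] h] _ -> /= w0; rewrite leq_subLR addnC.
rewrite -(wt_codeword l cardF a b c h) leq_add2l -(ler_nat rat).
have pp2 : (p <= p ^ 2)%N by rewrite -{1}[p]expn1 leq_exp2l ?prime_gt1.
rewrite natrD !natrM natrB // !natrX mulnC exprM.
apply: zeros_le => //; apply: contraNT w0; rewrite !negb_or !negbK.
case/and4P=> /eqP-> /eqP-> /eqP-> /eqP->; apply/eqP/ffunP=> x.
by rewrite !ffunE !mul0r !addr0 (Tr0 p_pr cardF).
Qed.

(** The bound on [c] keeps the number of zeros between [0] and [q]; the strict inequality is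
    [k * (p - 2) < d * (p - 1)] with [d] from [min_wt_D1]. The design parameter is then identified
    by cancelling [q * (q - 1) * (P - 1)]. *)
Lemma supports_form_2_designP (c : int) (lam : rat) :
    `|c%:~R| <= P * (P - 1) ->
    (q%:R - (P * t ^+ 2 + t * c%:~R)) * (P - 2%:R) <
      (q%:R - (P * t ^+ 2 + t * (P * (P - 1)))) * (P - 1) ->
    0 < numw c%:~R ->
    numw c%:~R * ((q%:R - (P * t ^+ 2 + t * c%:~R))
                  * (q%:R - (P * t ^+ 2 + t * c%:~R) - 1)) =
      lam * (q%:R * (q%:R - 1) * (P - 1)) ->
  supports_form_2_design F p m l (q%:R - (P * t ^+ 2 + t * c%:~R)) lam.
Proof.
move=> c_le k_small num_gt0 numE.
have p2 := ratp_gt2 p_pr p_odd; have tP := t_geP p_pr r_gt0.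
have qE := ratqE p mE.
have [[P0 t0 P1 t1 t1'] [Pt1 Pt1' D q0 q1] _ _ _] := weight_factors_gt0 p2 tP.
move: c_le; rewrite ler_norml => /andP[c_ge c_le].
have tc_ge : t * - (P * (P - 1)) <= t * c%:~R by rewrite ler_pM2l.
have tc_le : t * c%:~R <= t * (P * (P - 1)) by rewrite ler_pM2l.
have B1 : 0 <= t * (P * (t - (P - 1))) by rewrite !mulr_ge0 //; lra.
have B2 : 0 < t * (P * (P - 1) * (t - 1)) by rewrite !mulr_gt0.
have [z zE] : exists z : nat, z%:R = P * t ^+ 2 + t * c%:~R.
  pose zi : int := p%:Z * (p ^ r)%:Z ^+ 2 + (p ^ r)%:Z * c.
  have ziE : zi%:~R = P * t ^+ 2 + t * c%:~R.
    by rewrite /zi rmorphD !rmorphM /= -!pmulrn natrX.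
  have zi0 : 0 <= zi by rewrite -(ler0z rat) ziE; lra.
  by exists `|zi|%N; rewrite pmulrn gez0_abs.
have zq : (z <= q)%N by rewrite -(ler_nat rat) zE qE; lra.
have [k kz kE] : exists2 k, (k + z)%N = q & k%:R = q%:R - (P * t ^+ 2 + t * c%:~R).
  by exists (q - z)%N; rewrite ?subnK // natrB // zE.
have k_gt0 : (0 < k)%N by rewrite -(ltr_nat rat) kE qE; lra.
have AE := num_wtE p_pr p_odd cardF co_ml mE r_gt0 kz zE.
have cardB (b : {set F}) : b \in supports C k -> #|b| = k.
  by case/imsetP=> w + ->; rewrite inE => /andP[_ /eqP].
have [n [des nE]] := affine_2_design cardB (supports_affine (k := k)).
rewrite cardF in des nE.
exists k, n; split=> //.
  have p_gt0 := prime_gt0 p_pr; have q_gt0 : (0 < q)%N by rewrite expn_gt0 p_gt0.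
  pose B := (p * p ^ (2 * r) + (p ^ 2 - p) * p ^ r)%N.
  have pp2 : (p <= p ^ 2)%N by rewrite -{1}[p]expn1 leq_exp2l ?prime_gt1.
  have BE : B%:R = P * t ^+ 2 + t * (P * (P - 1)).
    rewrite natrD !natrM natrB // !natrX mulnC exprM; ring.
  have Bq : (B <= q)%N by rewrite -(ler_nat rat) BE qE; lra.
  have k_smallN : (k * (#|'F_p| - 2) < (q - B) * #|'F_p|.-1)%N.
    rewrite card_Fp // -(ltr_nat rat) !natrM -subn1 !natrB ?prime_gt1 //.
    by rewrite BE kE.
  have := num_wt_supports (D1_scale p_pr cardF) (D1_sub p_pr cardF) min_wt_D1
            k_gt0 k_smallN.
  rewrite card_Fp // => /(congr1 (fun n => n%:R : rat)).
  rewrite AE natrM -subn1 natrB // => AB.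
  have := congr1 (fun n => n%:R : rat) nE; rewrite /= !natrM -!subn1 !natrB // kE => nER.
  have dn : q%:R * (q%:R - 1) * (P - 1) != 0 :> rat.
    by rewrite qE !mulf_neq0 // gt_eqF.
  apply: (mulIf dn); rewrite -numE AB.
  transitivity (q%:R * ((q%:R - 1) * n%:R) * (P - 1)); first by ring.
  by rewrite nER; ring.
by rewrite -lt0n -(ltr_nat rat) AE.
Qed.

End DesignsFromWeights.

(** Every listed deviation is at least [- P], and then [P <= t] suffices. At [- (P * (P - 1))] the
    quantity becomes [P * (P - 1) * (t - 2 * P + 3)], which is not positive for [t = P >= 3]: hence
    the ninth pair is confined to [m >= 6]. *)
Lemma weight_bounds (P t x : rat) : 2%:R < P -> P <= t ->
    x \in [:: 0; - (P - 1); P - 1; P * (P - 1); -1; 1; - P; P] \/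
    x = - (P * (P - 1)) /\ P ^+ 2 <= t ->
  `|x| <= P * (P - 1) /\ 0 < P * (P - 1) * (t - (P - 1)) + x * (P - 2%:R).
Proof.
move=> P2 t_ge; have a0 : 0 < P * (P - 2%:R) by apply: mulr_gt0; lra.
have a1 : 0 < P * (P - 1) by lra.
case=> [xs|[-> t_ge2]]; last first.
  split; first by rewrite normrN ger0_norm //; lra.
  have : 0 < P * (P - 1) * (t - 2%:R * P + 3%:R) by apply: mulr_gt0; lra.
  by lra.
have [x1 x2] : - P <= x /\ x <= P * (P - 1).
  by move: xs; rewrite !inE; do 7?[case/orP]; move/eqP=> ->; split; lra.
split; first by rewrite ler_norml; apply/andP; split; lra.
have b1 : 0 <= P * (P - 1) * (t - P) by apply: mulr_ge0; lra.
have b2 : 0 <= (x + P) * (P - 2%:R) by apply: mulr_ge0; lra.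
by lra.
Qed.

Lemma weight_small (P t c : rat) : 0 < t ->
    0 < P * (P - 1) * (t - (P - 1)) + c * (P - 2%:R) ->
  (P ^+ 2 * t ^+ 2 - (P * t ^+ 2 + t * c)) * (P - 2%:R) <
  (P ^+ 2 * t ^+ 2 - (P * t ^+ 2 + t * (P * (P - 1)))) * (P - 1).
Proof. by move=> t0 /(mulr_gt0 t0) ?; lra. Qed.

(** The condition [0 < r] keeps every truncated subtraction in the exponents exact; [m %/ 2 - 2] is
    [r - 1], whence [t / P]. *)
Lemma half_dim_powers (P : rat) (m r : nat) (t := P ^+ r) :
    P != 0 -> m = (2 * r.+1)%N -> (0 < r)%N ->
  [/\ P ^+ m = P ^+ 2 * t ^+ 2, P ^+ (m - 1) = P * t ^+ 2, P ^+ (m - 2) = t ^+ 2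
    & P ^+ (m + 2) = P ^+ 4 * t ^+ 2] /\
  [/\ P ^+ (2 * m - 1) = P ^+ 3 * t ^+ 4, P ^+ (2 * m - 2) = P ^+ 2 * t ^+ 4
    & P ^+ (2 * m - 3) = P * t ^+ 4] /\
  [/\ P ^+ (m %/ 2) = P * t, P ^+ (m %/ 2 - 1) = t, P ^+ (m %/ 2 + 1) = P ^+ 2 * t
    & P ^+ (m %/ 2 - 2) = t / P] /\
  P ^+ ((m - 2) %/ 2) = t /\ P ^+ ((m + 2) %/ 2) = P ^+ 2 * t.
Proof.
move=> P0 mE r_gt0.
have powE n a b : n = (a + r * b)%N -> P ^+ n = P ^+ a * t ^+ b.
  by move=> ->; rewrite exprD exprM.
have h : (m %/ 2 = r.+1)%N by lia.
split; [split|split; [split|split; [split|split]]].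
- by apply: powE; lia.
- by apply: (powE _ 1%N 2%N); lia.
- by rewrite (powE _ 0%N 2%N) ?mul1r //; lia.
- by apply: powE; lia.
- by apply: powE; lia.
- by apply: powE; lia.
- by apply: (powE _ 1%N 4%N); lia.
- by rewrite h exprS.
- by congr (_ ^+ _); lia.
- by apply: (powE _ 2%N 1%N); lia.
- apply: (mulfI P0); rewrite -exprS mulrCA divff // mulr1.
  by congr (_ ^+ _); lia.
- by congr (_ ^+ _); lia.
by apply: (powE _ 2%N 1%N); lia.
Qed.

Lemma design_number_2_design (F : finFieldType) (p m l r : nat)
    (P := p%:R : rat) (t := P ^+ r) (c : int) (x lam i lam' : rat) :
    prime p -> odd p -> #|F| = (p ^ m)%N -> gcdn m l = 1%N ->
    m = (2 * r.+1)%N -> (0 < r)%N -> c%:~R = x ->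
    x \in [:: 0; - (P - 1); P - 1; P * (P - 1); -1; 1; - P; P] \/
    x = - (P * (P - 1)) /\ P ^+ 2 <= t ->
    design_number P t (num_type F p m l (1%N, P * t))
      (num_type F p m l (1%N, - (P * t))) (num_type F p m l (p, 0))
      (num_type F p m l ((p ^ 2)%N, P ^+ 2 * t))
      (num_type F p m l ((p ^ 2)%N, - (P ^+ 2 * t))) x lam ->
    i = P ^+ 2 * t ^+ 2 - (P * t ^+ 2 + t * x) -> lam' = lam ->
  supports_form_2_design F p m l i lam'.
Proof.
move=> p_pr p_odd cardF co_ml mE r_gt0 cx x_in [num_gt0 numE] -> ->.
have P2 : 2%:R < P := ratp_gt2 p_pr p_odd; have tP : P <= t := t_geP p_pr r_gt0.
have [x_le x_small] := weight_bounds P2 tP x_in.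
have t0 : 0 < t by apply: lt_le_trans tP; apply: lt_trans P2.
have qE : (p ^ m)%:R = P ^+ 2 * t ^+ 2 := ratqE p mE.
rewrite -qE -cx; apply: (supports_form_2_designP p_pr p_odd cardF co_ml mE r_gt0);
  rewrite ?cx ?qE //.
exact: weight_small.
Qed.

Theorem theorem4p5 (p m l : nat) (F : finFieldType)
    (p_prime : prime p) (p_odd : odd p) (m_even : ~~ odd m)
    (l_gt0 : (0 < l)%N) (co_ml : gcdn m l = 1%N) (cardF : #|F| = (p ^ m)%N) :
  let P : rat := p%:R in
  let pairs_1_8 : seq (rat * rat) :=
    [:: (P ^+ m - P ^+ (m - 1),
         (P ^+ m - P ^+ (m - 1) - 1)
         * (P ^+ (2 * m - 1) - P ^+ (2 * m - 2) + 2%:R * P ^+ (2 * m - 3)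
            - P ^+ (m - 2) + 1));
        (P ^+ m - P ^+ (m - 1) + P ^+ (m %/ 2) - P ^+ ((m - 2) %/ 2),
         P ^+ ((m + 2) %/ 2)
         * (P ^+ m - P ^+ (m - 1) + P ^+ ((m - 2) %/ 2) * (P - 1) - 1)
         * (P ^+ (m %/ 2) + 1)
         * (P ^+ m - P ^+ (m - 1) - P ^+ (m - 2) - P ^+ (m %/ 2)
            + P ^+ ((m - 2) %/ 2) + 1)
         / (2%:R * (P ^+ 2 - 1)));
        (P ^+ m - P ^+ (m - 1) - P ^+ (m %/ 2) + P ^+ ((m - 2) %/ 2),
         P ^+ ((m + 2) %/ 2)
         * (P ^+ m - P ^+ (m - 1) - P ^+ ((m - 2) %/ 2) * (P - 1) - 1)
         * (P ^+ (m %/ 2) - 1)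
         * (P ^+ m - P ^+ (m - 1) - P ^+ (m - 2) + P ^+ (m %/ 2)
            - P ^+ ((m - 2) %/ 2) + 1)
         / (2%:R * (P ^+ 2 - 1)));
        (P ^+ m - P ^+ (m - 1) - P ^+ ((m + 2) %/ 2) + P ^+ (m %/ 2),
         P ^+ (m %/ 2 - 2)
         * (P ^+ (m - 2) - 1)
         * (P ^+ (m %/ 2) - 1)
         * (P ^+ m - P ^+ (m - 1) - P ^+ ((m + 2) %/ 2) + P ^+ (m %/ 2) - 1)
         / (2%:R * (P ^+ 2 - 1)));
        (P ^+ m - P ^+ (m - 1) + P ^+ (m %/ 2 - 1),
         P ^+ ((m + 2) %/ 2)
         * (P ^+ m - P ^+ (m - 1) + P ^+ ((m - 2) %/ 2) - 1)
         * (P ^+ (m %/ 2 + 1) - P ^+ (m %/ 2) + 1)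
         * (P ^+ m - P ^+ (m - 1) - P ^+ (m - 2) + P ^+ (m %/ 2)
            - P ^+ ((m - 2) %/ 2) + 1)
         / (2%:R * (P ^+ 2 - 1)));
        (P ^+ m - P ^+ (m - 1) + P ^+ (m %/ 2),
         P ^+ (m %/ 2 - 2)
         * (P ^+ m - P ^+ (m - 1) + P ^+ (m %/ 2) - 1)
         * (P ^+ (m %/ 2) - P ^+ (m %/ 2 - 1) + 1)
         * (P ^+ (m + 2) - P ^+ m + P ^+ (m - 1) + P ^+ (m %/ 2)
            - P ^+ (m %/ 2 - 1) - 1)
         / (2%:R * (P ^+ 2 - 1)));
        (P ^+ m - P ^+ (m - 1) - P ^+ (m %/ 2 - 1),
         P ^+ ((m + 2) %/ 2)
         * (P ^+ m - P ^+ (m - 1) - P ^+ ((m - 2) %/ 2) - 1)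
         * (P ^+ (m %/ 2 + 1) - P ^+ (m %/ 2) - 1)
         * (P ^+ m - P ^+ (m - 1) - P ^+ (m - 2) - P ^+ (m %/ 2)
            + P ^+ ((m - 2) %/ 2) + 1)
         / (2%:R * (P ^+ 2 - 1)));
        (P ^+ m - P ^+ (m - 1) - P ^+ (m %/ 2),
         P ^+ (m %/ 2 - 2)
         * (P ^+ m - P ^+ (m - 1) - P ^+ (m %/ 2) - 1)
         * (P ^+ (m %/ 2) - P ^+ (m %/ 2 - 1) - 1)
         * (P ^+ (m + 2) - P ^+ m + P ^+ (m - 1) - P ^+ (m %/ 2)
            + P ^+ (m %/ 2 - 1) - 1)
         / (2%:R * (P ^+ 2 - 1)))] in
  let pair_9 : rat * rat :=
    (P ^+ m - P ^+ (m - 1) + P ^+ (m %/ 2) * (P - 1),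
     P ^+ (m %/ 2 - 2)
     * (P ^+ (m - 2) - 1)
     * (P ^+ (m %/ 2) + 1)
     * (P ^+ m - P ^+ (m - 1) + P ^+ (m %/ 2) * (P - 1) - 1)
     / (2%:R * (P ^+ 2 - 1))) in
  ((6 <= m)%N ->
     forall i lam : rat, (i, lam) \in rcons pairs_1_8 pair_9 ->
       supports_form_2_design F p m l i lam) /\
  (m = 4%N ->
     forall i lam : rat, (i, lam) \in pairs_1_8 ->
       supports_form_2_design F p m l i lam).
Proof.
move=> P pairs_1_8 pair_9.
have designs r (mE : m = (2 * r.+1)%N) : (0 < r)%N ->
    (forall i lam, (i, lam) \in pairs_1_8 -> supports_form_2_design F p m l i lam) /\
    ((1 < r)%N -> supports_form_2_design F p m l pair_9.1 pair_9.2).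
  move=> r_gt0; pose t := P ^+ r.
  have P_gt2 : 2%:R < P := ratp_gt2 p_prime p_odd.
  have t_ge : P <= t := t_geP p_prime r_gt0.
  have P0 : P != 0 by rewrite pnatr_eq0 -lt0n prime_gt0.
  have [[e0 e1 e2 e3] [[e4 e5 e6] [[e7 e8 e9 e10] [e11 e12]]]] :=
    half_dim_powers P0 mE r_gt0.
  have exps := (e0, e1, e2, e3, e4, (e5, e6, e7, e8), (e9, e10, e11, e12)).
  have [n1E n2E n3E n4E n5E] := num_typesE p_prime p_odd cardF co_ml mE r_gt0.
  (* The indices are those of the stated pairs, while [design_numbers] orders them by deviation. *)
  have [[d1 d2 d3 d4 d9] [d5 d7 d6 d8]] :=
    design_numbers P_gt2 t_ge n1E n2E n3E n4E n5E.
  have mk c x lam i lam' := @design_number_2_design F p m l r c x lam i lam'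
    p_prime p_odd cardF co_ml mE r_gt0.
  split=> [i lam|r_gt1]; last first.
    apply: (mk (- (p%:Z * (p%:Z - 1))) _ _ _ _ _ _ d9).
    - by rewrite rmorphN rmorphM rmorphB.
    - by right; split=> //; apply: ler_weXn2l => //; apply: ltW; apply: lt_trans P_gt2.
    - by rewrite /pair_9 /= !exps -/t; ring.
    by rewrite /pair_9 /= !exps.
  rewrite /pairs_1_8 !inE.
  have item c x lam0 i' lam' cx x_in d Ei El :=
    mk c x lam0 i' lam' cx (or_introl x_in) d Ei El.
  case/or4P=> [/eqP[-> ->]|/eqP[-> ->]|/eqP[-> ->]|].
  - by apply: (item 0 _ _ _ _ _ _ d1); rewrite ?inE ?eqxx ?orbT ?exps // -/P -/t; ring.
  - apply: (item (- (p%:Z - 1)) _ _ _ _ _ _ d2); rewrite ?inE ?eqxx ?orbT ?exps //.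
    + by rewrite rmorphN rmorphB.
    + by rewrite -/P -/t; ring.
  - apply: (item (p%:Z - 1) _ _ _ _ _ _ d3); rewrite ?inE ?eqxx ?orbT ?exps //.
    + by rewrite rmorphB.
    + by rewrite -/P -/t; ring.
  case/or4P=> [/eqP[-> ->]|/eqP[-> ->]|/eqP[-> ->]|/orP[]/eqP[-> ->]].
  - apply: (item (p%:Z * (p%:Z - 1)) _ _ _ _ _ _ d4); rewrite ?inE ?eqxx ?orbT ?exps //.
    + by rewrite rmorphM rmorphB.
    + by rewrite -/P -/t; ring.
  - apply: (item (-1) _ _ _ _ _ _ d5); rewrite ?inE ?eqxx ?orbT ?exps //.
    by rewrite -/P -/t; ring.
  - apply: (item (- p%:Z) _ _ _ _ _ _ d6); rewrite ?inE ?eqxx ?orbT ?exps //.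
    + by rewrite rmorphN.
    + by rewrite -/P -/t; ring.
    by rewrite -/P -/t; ring.
  - apply: (item 1 _ _ _ _ _ _ d7); rewrite ?inE ?eqxx ?orbT ?exps //.
    by rewrite -/P -/t; ring.
  apply: (item p%:Z _ _ _ _ _ _ d8); rewrite ?inE ?eqxx ?orbT ?exps //.
    by rewrite -/P -/t; ring.
  by rewrite -/P -/t; ring.
split=> [m_ge6|m4] i lam.
  have [] := designs (m./2.-1) _ _; [by lia | by lia |].
  move=> des18 des9; rewrite mem_rcons inE => /orP[/eqP pE|]; last exact: des18.
  by have := des9 _; rewrite -pE; apply; lia.
(* For [m = 4] one has [r = 1] and [t = P], where only the first eight pairs are obtained. *)
by have [] := designs 1%N _ _; [rewrite m4 | | move=> + _; apply].
Qed.
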